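(* Let $$F_{1,-}(x)=\frac{-1-x-2x^2-2x^3-2x^4-2x^5-x^6+x^7+x^8+2x^9+x^{10}+x^{11}-x^{14}}{-1+x+x^3+x^4-2x^8-x^9-2x^{10}+x^{13}+x^{15}},$$ $$F_{1,+}(x)=\frac{-1-x^2+x^6+2x^7+x^8+2x^9+x^{10}+x^{11}-x^{14}}{-1+2x-x^2+x^3-x^5-x^8-x^{10}+x^{11}-x^{12}+x^{13}+x^{15}},$$ $$F_{2,-}(x)=\frac{1+x+x^2+2x^3+2x^4+2x^5+2x^6+x^7-x^{10}-x^{11}-x^{12}}{1-x-x^2-x^4-x^5+x^8+2x^9+x^{10}+x^{11}+x^{12}+x^{13}-x^{14}},$$ $$F_{2,+}(x)=\frac{1+x^3-x^7-x^8-x^9-2x^{10}-x^{11}-x^{12}}{1-2x+x^3-x^4+x^6+x^8+x^{11}+x^{13}-x^{14}}$$ be the generating functions obtained from the truncated transfer matrices described in the context, and let $f_{1,-},f_{1,+},f_{2,-},f_{2,+}$ be the corresponding counting sequences. The denominators of $F_{1,-},F_{1,+},F_{2,-},F_{2,+}$ have unique minimal roots, respectively $$r=0.65149869151455837735\ldots,\quad s=0.65145978572056851317\ldots,\quad t=0.55979335021175578170\ldots,\quad u=0.55977426822528580510\ldots.$$ This gives the asymptotic lower bounds $$f_1(n)>f_{1,-}(n)=\Theta\big((1/r)^n\big)=\Theta(1.5349224995\ldots^n),\qquad f_2(n)>f_{2,-}(n)=\Theta\big((1/t)^n\big)=\Theta(1.786373489\ldots^n),$$ and the asymptotic upper bounds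 $$f_1(n)<f_{1,+}(n)=\Theta\big((1/s)^n\big)=\Theta(1.535014167\ldots^n),\qquad f_2(n)<f_{2,+}(n)=\Theta\big((1/u)^n\big)=\Theta(1.786434384\ldots^n).$$
   Context: A permutation $\pi:[n]\to[n]$, where $[n]=\{1,\ldots,n\}$, is $k$-convex (for an integer $k\ge 0$) if $\pi(i-1)+\pi(i+1)-2\pi(i)\le k$ for all $i\in\{2,\ldots,n-1\}$; $f_k(n)$ denotes the number of $k$-convex permutations of length $n$. The left and right descendants of $\pi$ are $L(\pi)=1(\pi(1)+1)\cdots(\pi(n)+1)$ and $R(\pi)=(\pi(1)+1)\cdots(\pi(n)+1)1$. For $k\in\{1,2\}$, the $k$-convex transition digraph has as vertices $k$-convex permutations up to having the same number of $k$-convex descendants in every generation (a permutation and its reverse are identified), with edges from a vertex to the vertices of its $k$-convex left and right descendants; a vertex is abbreviated by the first two and last two entries of a representative, and the starting vertex is the permutation 12. Half of the $k$-convex permutations are counted by walks in this infinite digraph starting at 12. For a finite truncation with adjacency matrix $M$ (12 being the first vertex), the generating function for walks by length is the sum of the first-row entries of $(I-xM)^{-1}$. The functions $F_{1,-}$ and $F_{2,-}$ come from truncating the digraph at the edge from 1267 to 1278 (for $k=1$) and at the edge from 1278 to 1289 (for $k=2$), leaving 22 and 24 vertices respectively; $F_{1,+}$ and $F_{2,+}$ come from these truncations with a loop inserted (described as a loop at 1267 for $k=1$, entered as a 1 in the 22nd row and column of the matrix, and as a loop at 1278 for $k=2$). The corresponding sequences are $f_{k,\pm}(n)=2[x^{n-2}]F_{k,\pm}(x)$,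 where $[x^m]$ denotes the coefficient of $x^m$.
   Formalization: The loop is put at the last vertex of some listing of the truncation, since a loop at 1267 (1278) contradicts the printed F_{k,+}; vertex counts 22, 24 are dropped (really 21, 22); the inequalities hold for all large n, as they fail for small n; decimals are read as rounded. *)

(* Defs.v *)
From mathcomp Require Import all_boot all_order all_algebra.
From mathcomp Require Import all_classical all_reals all_analysis.
From mathcomp Require Import complex.
Set Implicit Arguments.
Unset Strict Implicit.
Unset Printing Implicit Defensive.
Import Order.TTheory GRing.Theory Num.Theory.
Import numFieldNormedType.Exports.
Local Open Scope classical_set_scope.
Local Open Scope ring_scope.

(* Permutations of {1, ..., n} are words in one-line notation. *)
Notation word := (seq nat).

Definition is_perm (w : word) : bool :=
  (0 < size w)%N && perm_eq w (iota 1 (size w)).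

(* pi(i - 1) + pi(i + 1) - 2 pi(i) <= k, with the centre i = j + 2 in 1-based
   indexing, so that j ranges over 0, ..., n - 3. *)
Definition convex (k : nat) (w : word) : bool :=
  all (fun j => (nth 0%N w j)%:Z + (nth 0%N w j.+2)%:Z
                - 2 * (nth 0%N w j.+1)%:Z <= k%:Z)
      (iota 0 (size w - 2)).

Definition num_convex (k n : nat) : nat :=
  count (convex k) (permutations (iota 1 n)).

Definition ldesc (w : word) : word := 1%N :: map S w.
Definition rdesc (w : word) : word := rcons (map S w) 1%N.

Definition convex_children (k : nat) (w : word) : seq word :=
  [seq c <- [:: ldesc w; rdesc w] | convex k c].

(* All 2 ^ m descendants of w in the m-th generation. *)
Definition generation (m : nat) (w : word) : seq word :=
  iter m (fun s => flatten [seq [:: ldesc u; rdesc u] | u <- s]) [:: w].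

Definition num_desc (k m : nat) (w : word) : nat :=
  count (convex k) (generation m w).

(* Two k-convex permutations are the same vertex of the transition digraph;
   a permutation and its reverse are always identified by this relation. *)
Definition same_vertex (k : nat) (u w : word) : Prop :=
  forall m, num_desc k m u = num_desc k m w.

(* The edge on which the digraph is truncated, from the vertex of [a] to the
   vertex of [b]. *)
Definition cut_edge (k : nat) (a b u w : word) : Prop :=
  same_vertex k u a /\ same_vertex k w b.

(* Adjacency matrix, with the edge from [a] to [b] deleted, of the digraph on
   the vertices represented by the words [v i]. *)
Definition adjacency (k : nat) (a b : word) (n : nat) (v : 'I_n -> word) :
    'M[nat]_n :=
  \matrix_(i, j) count
    (fun c => `[< same_vertex k c (v j) /\ ~ cut_edge k a b (v i) c >])
    (convex_children k (v i)).

(* [v] lists, starting with 12, exactly one representative of each vertex that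
   can still be reached from 12 once the edge from [a] to [b] is deleted. *)
Definition truncation (k : nat) (a b : word) (n : nat)
    (v : 'I_n.+1 -> word) : Prop :=
  [/\ v ord0 = [:: 1; 2]%N,
      forall i, is_perm (v i) && convex k (v i),
      forall i j, same_vertex k (v i) (v j) -> i = j,
      forall i c, c \in convex_children k (v i) ->
        cut_edge k a b (v i) c \/ exists j, same_vertex k c (v j)
    & forall i, connect [rel i j | adjacency k a b v i j != 0%N] ord0 i].

(* The sum of the first-row entries of (I - x M)^-1. *)
Definition walk_gf (n : nat) (M : 'M[nat]_n.+1) : {fraction {poly rat}} :=
  \sum_j invmx (1%:M - tofrac 'X *: map_mx (fun m => m%:R) M) ord0 j.

(* For the upper-bound functions the loop sits at the last listed vertex of the
   truncation (entry in the last row and column). *)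
Definition add_loop (n : nat) (l : 'I_n) (M : 'M[nat]_n) : 'M[nat]_n :=
  \matrix_(i, j) (M i j + ((i == l) && (j == l)))%N.

Record ratfun := RatFun { num : {poly rat}; den : {poly rat} }.

Definition ratfun_frac (F : ratfun) : {fraction {poly rat}} :=
  tofrac (num F) / tofrac (den F).

(* The first [m] coefficients of the power series N / D, by long division:
   c_j = (N_j - sum_(i < j) D_(j - i) c_i) / D_0. *)
Fixpoint series_coefs (F : ratfun) (m : nat) : seq rat :=
  if m is m'.+1 then
    let s := series_coefs F m' in
    rcons s (((num F)`_m' - \sum_(i < m') (den F)`_(m' - i) * s`_i)
             / (den F)`_0)
  else [::].

Definition series_coef (F : ratfun) (m : nat) : rat :=
  (series_coefs F m.+1)`_m.

Lemma size_series_coefs F m : size (series_coefs F m) = m.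
Proof. by elim: m => //= m IH; rewrite size_rcons IH. Qed.

Lemma nth_series_coefs F m i :
  (i < m)%N -> (series_coefs F m)`_i = series_coef F i.
Proof.
elim: m => // m IH; rewrite ltnS leq_eqVlt => /orP[/eqP-> //|im].
by rewrite /= nth_rcons size_series_coefs im IH.
Qed.

Lemma series_coefP F m : (den F)`_0 != 0 ->
  \sum_(i < m.+1) (den F)`_(m - i) * series_coef F i = (num F)`_m.
Proof.
move=> D0; rewrite big_ord_recr /= subnn /(series_coef F m) /= nth_rcons.
rewrite size_series_coefs ltnn eqxx mulrCA divff // mulr1.
under eq_bigr => i _ do rewrite -(nth_series_coefs F (ltn_ord i)).
by rewrite addrC subrK.
Qed.


Definition F1m := RatFun
  (- 1 - 'X - 2 * 'X^2 - 2 * 'X^3 - 2 * 'X^4 - 2 * 'X^5 - 'X^6 + 'X^7 + 'X^8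
   + 2 * 'X^9 + 'X^10 + 'X^11 - 'X^14)
  (- 1 + 'X + 'X^3 + 'X^4 - 2 * 'X^8 - 'X^9 - 2 * 'X^10 + 'X^13 + 'X^15).

Definition F1p := RatFun
  (- 1 - 'X^2 + 'X^6 + 2 * 'X^7 + 'X^8 + 2 * 'X^9 + 'X^10 + 'X^11 - 'X^14)
  (- 1 + 2 * 'X - 'X^2 + 'X^3 - 'X^5 - 'X^8 - 'X^10 + 'X^11 - 'X^12 + 'X^13
   + 'X^15).

Definition F2m := RatFun
  (1 + 'X + 'X^2 + 2 * 'X^3 + 2 * 'X^4 + 2 * 'X^5 + 2 * 'X^6 + 'X^7 - 'X^10
   - 'X^11 - 'X^12)
  (1 - 'X - 'X^2 - 'X^4 - 'X^5 + 'X^8 + 2 * 'X^9 + 'X^10 + 'X^11 + 'X^12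
   + 'X^13 - 'X^14).

Definition F2p := RatFun
  (1 + 'X^3 - 'X^7 - 'X^8 - 'X^9 - 2 * 'X^10 - 'X^11 - 'X^12)
  (1 - 2 * 'X + 'X^3 - 'X^4 + 'X^6 + 'X^8 + 'X^11 + 'X^13 - 'X^14).

(* f(n) = 2 [x^(n - 2)] F(x), meaningful for n >= 2. *)
Definition counting_seq (F : ratfun) (n : nat) : rat :=
  2 * series_coef F (n - 2).

(* [r] is a complex root of [D] of strictly smaller modulus than all others. *)
Definition unique_minimal_root (R : realType) (D : {poly rat}) (r : R) : Prop :=
  root (map_poly ratr D) r%:C%C /\
  forall z : R[i], root (map_poly ratr D) z -> z != r%:C%C -> `|r%:C%C| < `|z|.

(* The decimal number a.d_1 d_2 ... d_m. *)
Definition decimal (R : realType) (a : nat) (ds : seq nat) : R :=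
  a%:R + \sum_(i < size ds) (nth 0%N ds i)%:R / 10 ^+ i.+1.

(* [x] is a.d_1 ... d_m when rounded to m decimals. *)
Definition rounds_to (R : realType) (x : R) (a : nat) (ds : seq nat) : Prop :=
  `|x - decimal R a ds| < (10 ^+ size ds)^-1 / 2.

Definition exp_growth (R : realType) (F : ratfun) (b : R) : Prop :=
  (fun n : nat => ratr (counting_seq F n) : R^o)
    \is 'Theta_\oo (fun n : nat => b ^+ n : R^o).

(* Main.v *)
From Stdlib Require Import ZArith.
Require Import Defs.
From mathcomp Require Import all_boot all_order all_algebra.
From mathcomp Require Import all_classical all_reals all_analysis.
From mathcomp Require Import complex.
From mathcomp Require Import zify ssrZ ring lra.
Import Order.TTheory GRing.Theory Num.Theory.
Import numFieldNormedType.Exports.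

Set Implicit Arguments.
Unset Strict Implicit.
Unset Printing Implicit Defensive.

(* Removing the entry 1, which for k <= 2 sits at an end, shows that a k-convex
   permutation is a descendant of 12 or 21, and how a permutation may be extended
   depends only on a small state attached to each of its two ends. Hence equality
   of vertices is decided by comparing states on one side and finitely many
   descendant counts on the other, and the truncated digraph is computed.

   For an adjacency matrix M let P_i / D be the generating function of the walks
   from i, so that P_i = D + x sum_j M_ij P_j. This polynomial identity gives the
   transfer-matrix formula, identifies the series coefficients with walk counts
   and, at a root r of D, says that (P_i(r)) is an eigenvector of M for 1/r; as it
   is positive, walk counts are of exact order (1/r)^n. Uniqueness of the minimal
   root follows from D(r w) = (1 - w) sum_k S_k w^k, S_k the partial sums of the
   coefficients of D(r w), when |S_0| dominates the sum of the other |S_k|.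

   Walks of the truncated digraph inject into descendants of 12, not onto. For
   the upper bound, 12...(n+1) has at most as many descendants as 12...n, so
   descendants are bounded by walks with a loop at 12...n. The loop at the
   truncation point only gives growth rate 1/s (resp. 1/u) again, but one vertex
   further the rate is already smaller, so F_+ eventually wins. *)

(** * Convex permutations as pairs of end states *)

Section Words.
Variable k : nat.
Implicit Types (w u c : word) (m n : nat).

Lemma convexE w :
  convex k w = [forall j : 'I_(size w - 2),
    (nth 0 w j + nth 0 w j.+2 <= 2 * nth 0 w j.+1 + k)%N].
Proof.
apply/allP/forallP => [H j | H j].
  have := H j; rewrite mem_iota /= add0n ltn_ord => /(_ isT); lia.
rewrite mem_iota add0n => /= jlt; have := H (Ordinal jlt) => /=; lia.
Qed.

Lemma convexP w :
  reflect (forall j, (j.+2 < size w)%N ->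
             (nth 0 w j + nth 0 w j.+2 <= 2 * nth 0 w j.+1 + k)%N)
          (convex k w).
Proof.
rewrite convexE; apply: (iffP forallP) => H j; last by apply: H; have := ltn_ord j; lia.
move=> jw; have jlt : (j < size w - 2)%N by lia.
exact: (H (Ordinal jlt)).
Qed.

Lemma convex_rev w : convex k (rev w) = convex k w.
Proof.
suff half v : convex k v -> convex k (rev v).
  by apply/idP/idP => [/half|/half //]; rewrite revK.
move=> /convexP H; apply/convexP => j; rewrite size_rev => jv.
rewrite !nth_rev; try lia.
have := H (size v - j.+3) ltac:(lia).
have -> : (size v - j.+3).+2 = size v - j.+1 by lia.
have -> : (size v - j.+3).+1 = size v - j.+2 by lia.
lia.
Qed.

Lemma convex_mapS w : convex k (map S w) = convex k w.
Proof.
apply/convexP/convexP => H j; move: (H j); rewrite size_map => Hj jw;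
  move: (Hj jw); rewrite !(nth_map 0); lia.
Qed.

Lemma convex_cons x w : (1 < size w)%N ->
  convex k (x :: w) = (x + nth 0 w 1 <= 2 * nth 0 w 0 + k)%N && convex k w.
Proof.
move=> w2; apply/convexP/andP => [H | [H0 /convexP H] [|j] //= jw].
  split; first by apply: (H 0) => /=; lia.
  by apply/convexP => j jw; apply: (H j.+1).
by apply: H; lia.
Qed.

Lemma size_ldesc w : size (ldesc w) = (size w).+1.
Proof. by rewrite /= size_map. Qed.

Lemma size_rdesc w : size (rdesc w) = (size w).+1.
Proof. by rewrite size_rcons size_map. Qed.

Lemma rev_ldesc w : rev (ldesc w) = rdesc (rev w).
Proof. by rewrite /ldesc /rdesc rev_cons map_rev. Qed.

Lemma rev_rdesc w : rev (rdesc w) = ldesc (rev w).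
Proof. by rewrite -(revK w) -rev_ldesc !revK. Qed.

(* For an end reading x y ... from outside in, the pair is (x, p) where p is the
   number of further generations, each raising x and y by 1, before a new 1 may
   be put next to x, that is before y <= 2 x + k. *)
Definition endpair w : nat * nat :=
  (nth 0 w 0, nth 0 w 1 - (2 * nth 0 w 0 + k)).
Definition state w := (endpair w, endpair (rev w)).
(** [grow] is the effect on an end of a new 1 at the opposite end, [reset] that of a new 1 at this
    end: the outermost entries become 1 and x + 1, and x + 1 - (2 + k) is the new waiting time. *)
Definition grow (s : nat * nat) : nat * nat := (s.1.+1, s.2.-1).
Definition reset (s : nat * nat) : nat * nat := (1, s.1 - k.+1).

Lemma convex_ldesc w : (1 < size w)%N ->
  convex k (ldesc w) = ((state w).1.2 == 0) && convex k w.
Proof.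
move=> w2; rewrite convex_cons ?size_map // convex_mapS !(nth_map 0); try lia.
by rewrite subn_eq0; congr andb; apply/idP/idP; lia.
Qed.

Lemma convex_rdesc w : (1 < size w)%N ->
  convex k (rdesc w) = ((state w).2.2 == 0) && convex k w.
Proof.
move=> w2; rewrite -convex_rev rev_rdesc convex_ldesc ?size_rev //.
by rewrite convex_rev.
Qed.

Lemma endpair_ldesc w : (0 < size w)%N -> endpair (ldesc w) = reset (endpair w).
Proof. by case: w => // a w _; rewrite /endpair /reset /=; congr pair; lia. Qed.

Lemma endpair_rdesc w : (1 < size w)%N -> endpair (rdesc w) = grow (endpair w).
Proof.
case: w => [|a [|b w]] // _; rewrite /endpair /grow /=; congr pair; lia.
Qed.

Lemma state_ldesc w : (1 < size w)%N ->
  state (ldesc w) = (reset (state w).1, grow (state w).2).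
Proof.
move=> w2; rewrite /state rev_ldesc endpair_ldesc; last by lia.
by rewrite endpair_rdesc ?size_rev.
Qed.

Lemma state_rdesc w : (1 < size w)%N ->
  state (rdesc w) = (grow (state w).1, reset (state w).2).
Proof.
move=> w2; rewrite /state rev_rdesc endpair_rdesc //.
by rewrite endpair_ldesc // size_rev; lia.
Qed.

Definition descend (s : seq word) := flatten [seq [:: ldesc u; rdesc u] | u <- s].

Lemma descend_cat s t : descend (s ++ t) = descend s ++ descend t.
Proof. by rewrite /descend map_cat flatten_cat. Qed.

Lemma iter_descend_cat m s t :
  iter m descend (s ++ t) = iter m descend s ++ iter m descend t.
Proof. by elim: m => //= m ->; rewrite descend_cat. Qed.

Lemma num_descS m w :
  num_desc k m.+1 w = num_desc k m (ldesc w) + num_desc k m (rdesc w).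
Proof.
rewrite /num_desc -[generation m.+1 w]/(iter m.+1 descend [:: w]) iterSr -count_cat.
by rewrite -iter_descend_cat.
Qed.

(** A descendant contains the word, shifted by a constant, as a factor, so a violation of convexity
    is inherited. *)
Lemma num_desc_nonconvex m w : (1 < size w)%N -> ~~ convex k w ->
  num_desc k m w = 0.
Proof.
elim: m w => [|m IH] w w2 nw; first by rewrite /num_desc /= (negbTE nw).
by rewrite num_descS !IH ?size_ldesc ?size_rdesc ?convex_ldesc ?convex_rdesc ?(negbTE nw) ?andbF //; lia.
Qed.

Lemma num_desc_children m w : (1 < size w)%N ->
  num_desc k m.+1 w = \sum_(c <- convex_children k w) num_desc k m c.
Proof.
move=> w2; rewrite num_descS big_filter big_mkcond !big_cons big_nil /= addn0.
by congr addn; case: ifP => // /negbT; apply: num_desc_nonconvex;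
  rewrite ?size_ldesc ?size_rdesc; lia.
Qed.

Fixpoint count_state m (s : (nat * nat) * (nat * nat)) : nat :=
  if m is m'.+1 then
    (if s.1.2 == 0 then count_state m' (reset s.1, grow s.2) else 0) +
    (if s.2.2 == 0 then count_state m' (grow s.1, reset s.2) else 0)
  else 1.

Lemma num_descE m w : (1 < size w)%N -> convex k w ->
  num_desc k m w = count_state m (state w).
Proof.
elim: m w => [|m IH] w w2 cw; first by rewrite /num_desc /= cw.
rewrite num_descS; congr addn.
  case: ifP => e; first by rewrite IH ?state_ldesc ?convex_ldesc ?e ?size_ldesc //; lia.
  by rewrite num_desc_nonconvex ?convex_ldesc ?e ?size_ldesc //; lia.
case: ifP => e; first by rewrite IH ?state_rdesc ?convex_rdesc ?e ?size_rdesc //; lia.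
by rewrite num_desc_nonconvex ?convex_rdesc ?e ?size_rdesc //; lia.
Qed.

Lemma count_state_swap m s t : count_state m (s, t) = count_state m (t, s).
Proof.
elim: m s t => //= m IH s t.
by rewrite addnC (IH (grow s) (reset t)) (IH (reset s) (grow t)).
Qed.

Definition pair_le (s t : nat * nat) := (s.1 <= t.1) && (s.2 <= t.2).

(** [grow] and [reset] are monotone for [pair_le], so an insertion that the larger end states allow
    is allowed by the smaller ones too. *)
Lemma count_state_anti m s1 s2 t1 t2 : pair_le s1 t1 -> pair_le s2 t2 ->
  count_state m (t1, t2) <= count_state m (s1, s2).
Proof.
elim: m s1 s2 t1 t2 => //= m IH s1 s2 t1 t2 /andP[h11 h12] /andP[h21 h22].
apply: leq_add; case: eqP => // e.
  have -> : s1.2 = 0 by lia.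
  by apply: IH; rewrite /pair_le /=; lia.
have -> : s2.2 = 0 by lia.
by apply: IH; rewrite /pair_le /=; lia.
Qed.

(** The second alternative accounts for reversal. *)
Definition same_state u w :=
  (state u == state w) || (state u == ((state w).2, (state w).1)).

Definition proper_convex w := (1 < size w)%N && convex k w.

Lemma same_state_vertex u w : proper_convex u -> proper_convex w -> same_state u w -> same_vertex k u w.
Proof.
move=> /andP[u2 cu] /andP[w2 cw] /orP[] /eqP e m; rewrite !num_descE // e //.
by rewrite count_state_swap -surjective_pairing.
Qed.

Lemma proper_convex_children w c : proper_convex w -> c \in convex_children k w -> proper_convex c.
Proof.
move=> /andP[w2 cw]; rewrite mem_filter !inE => /andP[cc /orP[]/eqP e];
  by rewrite /proper_convex cc andbT e ?size_ldesc ?size_rdesc; lia.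
Qed.

(** A finite part of the data compared by [same_vertex]: words with different profiles are different
    vertices. *)
Definition profile p w := [seq count_state m (state w) | m <- iota 0 p].

Lemma same_vertex_profile p u w : proper_convex u -> proper_convex w -> same_vertex k u w ->
  profile p u = profile p w.
Proof.
move=> /andP[u2 cu] /andP[w2 cw] H; apply: eq_map => m.
by rewrite -!num_descE.
Qed.

Lemma proper_convex_iota n : (1 < n)%N -> proper_convex (iota 1 n).
Proof.
move=> n2; rewrite /proper_convex size_iota n2; apply/convexP => j; rewrite size_iota => jn.
by rewrite !nth_iota; lia.
Qed.

(* The right end of 12...n waits longer for its next use when n grows. *)
Lemma num_desc_iota m n : (1 < n)%N ->
  num_desc k m (iota 1 n.+1) <= num_desc k m (iota 1 n).
Proof.
move=> n2; have /andP[s1 c1] := proper_convex_iota n2.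
have /andP[s2 c2] := @proper_convex_iota n.+1 (ltnW n2).
rewrite !num_descE //; apply: count_state_anti; rewrite /pair_le.
  by case: n n2 {s1 c1 s2 c2} => [|[|n]] //= n2; rewrite /endpair /= !leqnn.
have nthE j p : j < p -> nth 0 (rev (iota 1 p)) j = p - j.
  by move=> jp; rewrite nth_rev size_iota ?nth_iota; lia.
by rewrite /endpair !nthE /=; lia.
Qed.

(** The left descendant of 12...n is 12...(n+1), which is again convex. *)
Lemma num_desc_iota_gt0 m n : (1 < n)%N -> 0 < num_desc k m (iota 1 n).
Proof.
elim: m n => [|m IH] n n2; first by rewrite /num_desc /=; case/andP: (proper_convex_iota n2) => _ ->.
rewrite num_descS addn_gt0 (_ : ldesc _ = iota 1 n.+1) ?IH //; first by lia.
by rewrite /ldesc [RHS]/= (iotaDl 1 1).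
Qed.

End Words.

(** * Convex permutations as descendants of 12 and 21 *)

Lemma perm_descend s : perm_eq (descend s) (map ldesc s ++ map rdesc s).
Proof.
elim: s => //= w s IH; rewrite perm_cons -[rdesc w :: flatten _]cat1s.
rewrite -[rdesc w :: map _ _]cat1s perm_sym perm_catCA perm_cat2l.
by rewrite perm_sym.
Qed.

(** Only convex words have convex children, so the other words may be dropped before descending. *)
Lemma filter_convex_descend k s : {in s, forall w, 1 < size w} ->
  [seq c <- descend s | convex k c] =
  [seq c <- descend [seq w <- s | convex k w] | convex k c].
Proof.
elim: s => // w s IH ws.
rewrite -[descend (w :: s)]/(descend [:: w] ++ descend s) filter_cat IH; last first.
  by move=> u us; apply: ws; rewrite inE us orbT.
have w2 : 1 < size w by apply: ws; rewrite mem_head.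
rewrite [[seq _ <- w :: s | _]]/=; case: ifP => cw.
  by rewrite -filter_cat.
by rewrite /= convex_ldesc // convex_rdesc // cw !andbF.
Qed.

(* An interior 1 would have two distinct neighbours summing to at least 5. *)
Lemma convex_one_at_end k n w : k <= 2 -> perm_eq w (iota 1 n.+1) -> convex k w ->
  (exists2 u, w = ldesc u & perm_eq u (iota 1 n)) \/
  (exists2 u, w = rdesc u & perm_eq u (iota 1 n)).
Proof.
move=> k2 pw cw.
have sw : size w = n.+1 by rewrite (perm_size pw) size_iota.
have uw : uniq w by rewrite (perm_uniq pw) iota_uniq.
have mw x : (x \in w) = (0 < x < n.+2) by rewrite (perm_mem pw) mem_iota add1n.
have w1 : 1 \in w by rewrite mw.
have shift v : perm_eq v (iota 2 n) ->
    exists2 u, v = map S u & perm_eq u (iota 1 n).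
  rewrite (iotaDl 1 1) => pv; exists (map predn v).
    rewrite -map_comp -[LHS]map_id; apply/eq_in_map => x.
    by rewrite (perm_mem pv) => /mapP[y _ ->].
  rewrite (perm_trans (perm_map _ pv)) // -map_comp -[X in perm_eq _ X]map_id.
  by rewrite (@eq_map _ _ (predn \o addn 1) id).
have iE : nth 0 w (index 1 w) = 1 by rewrite nth_index.
have il : index 1 w < n.+1 by rewrite -sw index_mem.
case: (posnP (index 1 w)) => [i0|ipos].
  left; case: w pw {cw sw uw mw w1 il} iE i0 => [|x v] pw // iE i0.
  move: iE pw; rewrite i0 /= => -> /=; rewrite perm_cons => /shift[u -> pu].
  by exists u.
case: (ltngtP (index 1 w) n) => [iln||iE']; [|lia|].
  have /convexP/(_ (index 1 w).-1) := cw.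
  rewrite prednK // sw iE => /(_ ltac:(lia)) H.
  have m1 : nth 0 w (index 1 w).-1 \in w by apply: mem_nth; lia.
  have m2 : nth 0 w (index 1 w).+1 \in w by apply: mem_nth; lia.
  have e i : nth 0 w i = 1 -> i < n.+1 -> i = index 1 w.
    by move=> <- il'; rewrite index_uniq ?sw.
  have d : nth 0 w (index 1 w).-1 != nth 0 w (index 1 w).+1.
    by rewrite nth_uniq ?sw //; lia.
  have n1 : nth 0 w (index 1 w).-1 <> 1 by move/e => h; have := h ltac:(lia); lia.
  have n2 : nth 0 w (index 1 w).+1 <> 1 by move/e => h; have := h ltac:(lia); lia.
  move: m1 m2; rewrite !mw => m1 m2.
  by move/eqP: d; lia.
right; case/lastP: w pw sw iE iE' {cw uw mw w1 il ipos} => // v x pw.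
rewrite size_rcons => -[sv] iE' iE.
move: iE'; rewrite iE nth_rcons sv ltnn eqxx => x1; subst x.
move: pw; rewrite (perm_sym _ (iota _ _)) perm_sym perm_rcons /= perm_cons => /shift[u -> pu].
by exists u.
Qed.

(** Induction on [n]. Both lists are free of repetitions, so comparing members suffices:
    [convex_one_at_end] strips the 1 from a convex permutation, and descendants of permutations are
    permutations. *)
Lemma filter_convex_permutations k n : k <= 2 ->
  perm_eq [seq w <- permutations (iota 1 n.+2) | convex k w]
          [seq w <- iter n descend [:: [:: 1; 2]; [:: 2; 1]] | convex k w].
Proof.
move=> k2; elim: n => [|n IH].
  by apply: uniq_perm; rewrite ?filter_uniq ?permutations_uniq.
have szi : {in iter n descend [:: [:: 1; 2]; [:: 2; 1]], forall w, 1 < size w}.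
  elim: n {IH} => [|n IH] w; first by rewrite !inE => /orP[]/eqP->.
  rewrite [iter _ _ _]/= (perm_mem (perm_descend _)) mem_cat.
  by case/orP => /mapP[u /IH u2 ->]; rewrite ?size_ldesc ?size_rdesc; apply: ltnW.
set T := [seq w <- _ | _] in IH.
rewrite [iter _ _ _]/= filter_convex_descend //.
have pS : perm_eq (descend T) (descend [seq w <- iter n descend [:: [:: 1; 2]; [:: 2; 1]] | convex k w]).
  by rewrite !(permPl (perm_descend _)) perm_sym (permPl (perm_descend _)) perm_sym perm_cat ?perm_map.
have {pS} /permPr <- := perm_filter (convex k) pS.
have uS : uniq T by rewrite filter_uniq ?permutations_uniq.
have mS w : (w \in T) = convex k w && perm_eq w (iota 1 n.+2).
  by rewrite mem_filter mem_permutations.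
have sS w : w \in T -> 1 < size w.
  by rewrite mS => /andP[_ /perm_size ->]; rewrite size_iota.
apply: uniq_perm; rewrite ?filter_uniq ?permutations_uniq //.
  rewrite (perm_uniq (perm_descend _)) cat_uniq !map_inj_uniq ?uS //=.
  (* Left and right descendants never coincide: [rdesc u] starting with 1 would make the first entry
     of [u] zero. *)
  - apply/andP; split=> //; apply/hasPn => w /mapP[u uS' ->] /=; apply/mapP => -[u' u'S].
    have := uS'; rewrite mS => /andP[_ /perm_mem pu].
    have := pu (nth 0 u 0); rewrite mem_nth ?(ltnW (sS _ uS')) // mem_iota.
    case: u {uS' pu} (sS _ uS') => [|a u] //= _ a0 [] a1.
    by move: a0; lia.
  - by move=> u v /rcons_inj[] /(inj_map succn_inj).
  - by move=> u v [] /(inj_map succn_inj).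
move=> w; rewrite !mem_filter mem_permutations (perm_mem (perm_descend _)) mem_cat.
case cw : (convex k w) => //=; apply/idP/orP.
  move=> pw; case: (@convex_one_at_end k n.+2 w k2 pw cw) => -[u e pu]; [left|right];
    apply/mapP; exists u => //; rewrite mS pu andbT.
    by move: cw; rewrite e convex_ldesc ?(perm_size pu) ?size_iota // => /andP[].
  by move: cw; rewrite e convex_rdesc ?(perm_size pu) ?size_iota // => /andP[].
have pi : perm_eq (map S (iota 1 n.+2)) (iota 2 n.+2) by rewrite (iotaDl 1 1).
case=> /mapP[u]; rewrite mS => /andP[_ pu] -> /=.
  by rewrite perm_cons (perm_trans (perm_map _ pu)).
by rewrite perm_rcons perm_cons (perm_trans (perm_map _ pu)).
Qed.

(** The factor 2 arises because 21 is the reverse of 12 and so has as many convex descendants in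
    each generation. *)
Lemma num_convexE k n : k <= 2 ->
  num_convex k n.+2 = 2 * num_desc k n [:: 1; 2].
Proof.
move=> k2; rewrite /num_convex -size_filter (perm_size (filter_convex_permutations n k2)).
rewrite size_filter -[[:: _; [:: 2; 1]]]/([:: [:: 1; 2]] ++ [:: [:: 2; 1]]).
rewrite iter_descend_cat count_cat.
rewrite -![count _ (iter _ _ _)]/(num_desc _ _ _) mul2n -addnn; congr addn.
by apply: same_state_vertex => //; rewrite /same_state /state /endpair /=; apply/orP; right; apply/eqP.
Qed.

(** * The truncated digraph *)

Fixpoint walks (nb : seq (seq nat)) m i : nat :=
  if m is m'.+1 then sumn [seq walks nb m' j | j <- nth [::] nb i] else 1.

Definition count_mx n (nb : seq (seq nat)) : 'M[nat]_n :=
  \matrix_(i, j) count_mem (j : nat) (nth [::] nb i).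

Lemma leq_sumn_map (T : eqType) (s : seq T) (F G : T -> nat) :
  {in s, forall j, F j <= G j} -> sumn (map F s) <= sumn (map G s).
Proof.
move=> FG; rewrite !sumnE !big_map big_seq [leqRHS]big_seq.
exact: leq_sum.
Qed.

Section Truncation.
Variables (k : nat) (a b : word) (ws : seq word).

(** Computable counterpart of [cut_edge], with states in place of the infinitely many counts of
    [same_vertex]. *)
Definition is_cut w c := same_state k w a && same_state k c b.

(** A child that no listed word represents gets the index [size ws], so [in_range] expresses that
    the list is closed under kept children. *)
Definition kept_nbrs w :=
  [seq find (same_state k c) ws | c <- convex_children k w & ~~ is_cut w c].

(* The cut edge from [a] to [b] is replaced by a loop at [a]. *)
Definition redirected_nbrs w :=
  [seq find (same_state k (if is_cut w c then a else c)) ws | c <- convex_children k w].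

Definition graph_words := [:: a, b & ws ++ flatten (map (convex_children k) ws)].

(** Equal states always give equal vertices; this check supplies the converse on [graph_words], the
    words whose vertices have to be compared. *)
Definition separated p :=
  let us := [seq (u, profile k p u) | u <- graph_words] in
  all (fun x => all (fun y => (x.2 == y.2) ==> same_state k x.1 y.1) us) us.

Definition in_range nb := all (all (fun j => j < size ws)) nb.

(* The last condition gives every vertex a predecessor of smaller index, hence
   a path from the first one. *)
Definition truncation_check p :=
  [&& [&& proper_convex k a, proper_convex k b, all (fun w => is_perm w && proper_convex k w) ws &
       nth [::] ws 0 == [:: 1; 2]],
      separated p,
      all (fun i => all (fun j => same_state k (nth [::] ws i) (nth [::] ws j) ==> (i == j))
             (iota 0 (size ws))) (iota 0 (size ws)),
      in_range (map kept_nbrs ws) &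
      all (fun i => has (fun j => i \in kept_nbrs (nth [::] ws j)) (iota 0 i))
          (iota 1 (size ws).-1)].

Lemma num_desc_kept m w : proper_convex k w -> all (proper_convex k) ws ->
  all (fun j => j < size ws) (kept_nbrs w) ->
  sumn [seq num_desc k m (nth [::] ws j) | j <- kept_nbrs w] +
    \sum_(c <- convex_children k w | is_cut w c) num_desc k m c = num_desc k m.+1 w.
Proof.
move=> gw gws rng; rewrite num_desc_children; last by case/andP: gw.
rewrite [RHS](bigID (is_cut w)) /= addnC; congr addn.
rewrite sumnE !big_map big_filter.
rewrite [LHS]big_seq_cond [RHS]big_seq_cond; apply: eq_bigr => c /andP[cw nc].
have fc : find (same_state k c) ws < size ws.
  by apply: (allP rng); apply/mapP; exists c; rewrite // mem_filter nc.
apply: esym; apply: same_state_vertex; first exact: proper_convex_children cw.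
  by apply: (allP gws); apply: mem_nth.
by apply: nth_find; rewrite has_find.
Qed.

(** Putting [a] in place of a child equivalent to [b] can only increase the count, by the last
    hypothesis. *)
Lemma num_desc_redirected m w : proper_convex k a -> proper_convex k b -> proper_convex k w -> all (proper_convex k) ws ->
  all (fun j => j < size ws) (redirected_nbrs w) ->
  num_desc k m b <= num_desc k m a ->
  num_desc k m.+1 w <= sumn [seq num_desc k m (nth [::] ws j) | j <- redirected_nbrs w].
Proof.
move=> ga gb gw gws rng ba; rewrite num_desc_children; last by case/andP: gw.
rewrite sumnE !big_map big_seq [leqRHS]big_seq; apply: leq_sum => c cw.
set c' := if _ then _ else _.
have gc : proper_convex k c by apply: proper_convex_children cw.
have gc' : proper_convex k c' by rewrite /c'; case: ifP.
have fc : find (same_state k c') ws < size ws.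
  by apply: (allP rng); apply/mapP; exists c.
have <- : num_desc k m c' = num_desc k m (nth [::] ws (find (same_state k c') ws)).
  apply: same_state_vertex => //; first by apply: (allP gws); apply: mem_nth.
  by apply: nth_find; rewrite has_find.
rewrite /c'; case: ifP => // /andP[_ cb].
by rewrite (same_state_vertex gc gb cb).
Qed.

Lemma num_desc_le_walks m i : proper_convex k a -> proper_convex k b -> all (proper_convex k) ws ->
  in_range (map redirected_nbrs ws) -> i < size ws ->
  (forall l, num_desc k l b <= num_desc k l a) ->
  num_desc k m (nth [::] ws i) <= walks (map redirected_nbrs ws) m i.
Proof.
move=> ga gb gws rng iws ba; elim: m i iws => [|m IH] i iws.
  by rewrite /num_desc /=; case: (convex _ _).
have wi := mem_nth [::] iws.
have rngi : all (fun j => j < size ws) (redirected_nbrs (nth [::] ws i)).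
  by apply: (allP rng); apply: map_f.
apply: leq_trans (num_desc_redirected _ _ _ _ _ _) _ => //; first exact: (allP gws).
rewrite /= (nth_map [::]) //.
by apply: leq_sumn_map => j jl; apply: IH; apply: (allP rngi).
Qed.

(** * Soundness of the computed truncation *)

Section Checked.
Variables (p : nat).
Hypothesis check : truncation_check p.

Let ga : proper_convex k a. Proof. by case/and5P: check => /and4P[]. Qed.
Let gb : proper_convex k b. Proof. by case/and5P: check => /and4P[]. Qed.
Let gws : all (proper_convex k) ws.
Proof.
case/and5P: check => /and4P[_ _ H _] _ _ _ _.
by apply/allP => w /(allP H _)/andP[].
Qed.
Let rng : in_range (map kept_nbrs ws). Proof. by case/and5P: check. Qed.

Let good_word w : w \in graph_words -> proper_convex k w.
Proof.
rewrite !inE mem_cat => /orP[/eqP->//|/orP[/eqP->//|/orP[/(allP gws _)//|]]].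
by case/flatten_mapP => u /(allP gws _) gu; apply: proper_convex_children.
Qed.

(** Equal vertices have equal profiles, and [separated] turns these into equal states. *)
Let sameE u w : u \in graph_words -> w \in graph_words ->
  same_vertex k u w <-> same_state k u w.
Proof.
move=> gu gw; split; last by apply: same_state_vertex; apply: good_word.
move=> /(same_vertex_profile p (good_word gu) (good_word gw)) /eqP e.
case/and5P: check => _ /allP sep _ _ _.
have /allP sepu := sep (u, profile k p u) (map_f (fun v => (v, profile k p v)) gu).
by have /implyP/(_ e) := sepu (w, profile k p w) (map_f (fun v => (v, profile k p v)) gw).
Qed.

Let inW w : w \in ws -> w \in graph_words.
Proof. by move=> ww; rewrite !inE mem_cat ww !orbT. Qed.

Let inC w c : w \in ws -> c \in convex_children k w -> c \in graph_words.
Proof.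
by move=> ww cw; rewrite !inE mem_cat; apply/or4P/Or44; apply/flatten_mapP; exists w.
Qed.

Let cutE w c : w \in ws -> c \in convex_children k w ->
  cut_edge k a b w c <-> is_cut w c.
Proof.
move=> ww cw; have ia : a \in graph_words by rewrite mem_head.
have ib : b \in graph_words by rewrite inE mem_head orbT.
split=> [[/(sameE (inW ww) ia) ha /(sameE (inC ww cw) ib) hb]|/andP[ha hb]].
  by rewrite /is_cut ha.
by split; [apply/(sameE (inW ww) ia) | apply/(sameE (inC ww cw) ib)].
Qed.

Let same_inj i j : i < size ws -> j < size ws ->
  same_vertex k (nth [::] ws i) (nth [::] ws j) -> i = j.
Proof.
move=> iw jw /sameE; rewrite !inW ?mem_nth // => /(_ isT isT) s.
case/and5P: check => _ _ /allP/(_ i) + _ _; rewrite mem_iota iw => /(_ isT).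
by move=> /allP/(_ j); rewrite mem_iota jw => /(_ isT)/implyP/(_ s)/eqP.
Qed.

Let kept_lt w c : w \in ws -> c \in convex_children k w -> ~~ is_cut w c ->
  find (same_state k c) ws < size ws.
Proof.
move=> ww cw nc; apply: (allP (allP rng _ (map_f _ ww))).
by apply/mapP; exists c; rewrite // mem_filter nc.
Qed.

Let same_find w c : w \in ws -> c \in convex_children k w -> ~~ is_cut w c ->
  same_vertex k c (nth [::] ws (find (same_state k c) ws)).
Proof.
move=> ww cw nc; have fc := kept_lt ww cw nc.
apply/sameE; [exact: inC cw | by apply/inW/mem_nth |].
by apply: nth_find; rewrite has_find.
Qed.

Variables (n : nat) (size_ws : size ws = n.+1).

Let v (i : 'I_n.+1) := nth [::] ws i.

Let vW i : v i \in ws. Proof. by apply: mem_nth; rewrite size_ws. Qed.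

(** Listed words are pairwise different vertices, so a kept child is equivalent to [v j] exactly
    when [find] returns [j]. *)
Lemma adjacencyE : adjacency k a b v = count_mx n.+1 (map kept_nbrs ws).
Proof.
apply/matrixP => i j; rewrite !mxE (nth_map [::]) ?size_ws //.
rewrite count_map count_filter; apply: eq_in_count => c ci /=.
have cE := cutE (vW i) ci; apply/asboolP/andP => [[sc ncut]|[/eqP e nc]].
  have nc : ~~ is_cut (v i) c by apply/negP => /cE.
  split => //; apply/eqP; apply: same_inj; rewrite ?size_ws //.
    by rewrite -size_ws; apply: kept_lt (vW i) ci nc.
  by move=> m; rewrite -(same_find (vW i) ci nc).
split; last by move/cE => h; move: nc; rewrite h.
by rewrite /v -e; apply: same_find (vW i) ci nc.
Qed.

Lemma truncationP : truncation k a b v.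
Proof.
case/and5P: check => /and4P[_ _ pws /eqP w0] _ _ _ par; split.
- by rewrite /v w0.
- by move=> i; case/andP: (allP pws _ (vW i)) => -> /andP[_ ->].
- move=> i j /same_inj e; apply: ord_inj; apply: e; by rewrite size_ws.
- move=> i c ci; case nc : (is_cut (v i) c); [left|right].
    by apply/cutE.
  have lt : find (same_state k c) ws < n.+1.
    by rewrite -size_ws; apply: kept_lt (vW i) ci _; rewrite nc.
  by exists (Ordinal lt); apply: same_find (vW i) ci _; rewrite nc.
rewrite adjacencyE; case=> i; elim/ltn_ind: i => -[|i] IH ilt.
  by rewrite (_ : Ordinal ilt = ord0) ?connect0 //; apply: ord_inj.
have /hasP[j] := allP par i.+1 ltac:(by rewrite mem_iota size_ws).
rewrite mem_iota /= add0n => ji ij.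
have jn : j < n.+1 by apply: ltn_trans ji ilt.
apply: connect_trans (IH j ji jn) (connect1 _).
by rewrite /= mxE (nth_map [::]) ?size_ws //= -lt0n -has_count has_pred1.
Qed.

(** Each kept child is equivalent to its representative; deleting the cut edge only loses
    descendants. *)
Lemma walks_le_num_desc m i : i < size ws ->
  walks (map kept_nbrs ws) m i <= num_desc k m (nth [::] ws i).
Proof.
elim: m i => [|m IH] i iws.
  have /andP[_ cw] := allP gws _ (mem_nth [::] iws).
  by rewrite /num_desc /= cw.
have wi := mem_nth [::] iws.
have rngi := allP rng _ (map_f kept_nbrs wi).
rewrite -(num_desc_kept m (allP gws _ wi) gws rngi) /= (nth_map [::]) //.
apply: leq_trans (leq_addr _ _).
by apply: leq_sumn_map => j jl; apply: IH; apply: (allP rngi).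
Qed.

(** The descendants across the cut edge are missed by the walks, and there is at least one. *)
Lemma walks_lt_cut m i c : i < size ws ->
  c \in convex_children k (nth [::] ws i) -> is_cut (nth [::] ws i) c ->
  0 < num_desc k m b ->
  walks (map kept_nbrs ws) m.+1 i < num_desc k m.+1 (nth [::] ws i).
Proof.
move=> iws ci cc b0; have wi := mem_nth [::] iws.
have rngi := allP rng _ (map_f kept_nbrs wi).
rewrite -(num_desc_kept m (allP gws _ wi) gws rngi) /= (nth_map [::]) //.
rewrite -addn1; apply: leq_add.
  by apply: leq_sumn_map => j jl; apply: walks_le_num_desc; apply: (allP rngi).
rewrite (big_rem c ci) /= cc.
have /andP[_ cb] := cc.
by rewrite (same_state_vertex (good_word (inC wi ci)) gb cb) (leq_trans b0) ?leq_addr.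
Qed.

Lemma walks_lt_step m i j : i < size ws -> j \in kept_nbrs (nth [::] ws i) ->
  walks (map kept_nbrs ws) m j < num_desc k m (nth [::] ws j) ->
  walks (map kept_nbrs ws) m.+1 i < num_desc k m.+1 (nth [::] ws i).
Proof.
move=> iws ij lt; have wi := mem_nth [::] iws.
have rngi := allP rng _ (map_f kept_nbrs wi).
rewrite -(num_desc_kept m (allP gws _ wi) gws rngi) /= (nth_map [::]) //.
apply: leq_trans (leq_addr _ _).
move: (kept_nbrs _) ij rngi => s ij /allP rngi; rewrite !sumnE !big_map.
rewrite !(big_rem j ij) -addSn; apply: leq_add => //.
rewrite big_seq [leqRHS]big_seq; apply: leq_sum => l /mem_rem ls.
by apply: walks_le_num_desc; apply: rngi.
Qed.

(** A strict deficit at the end of a path is carried back to its start, one generation per edge. *)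
Lemma walks_lt_path m i s : i < size ws ->
  path (fun i j => (j < size ws) && (j \in kept_nbrs (nth [::] ws i))) i s ->
  walks (map kept_nbrs ws) m (last i s) < num_desc k m (nth [::] ws (last i s)) ->
  walks (map kept_nbrs ws) (size s + m) i < num_desc k (size s + m) (nth [::] ws i).
Proof.
elim: s i => //= j s IH i iws /andP[/andP[jws ij] js] lt.
exact: walks_lt_step ij (IH j jws js lt).
Qed.

End Checked.
End Truncation.

(** One round of breadth-first search. New words are appended, so 12 keeps index 0 and each later
    word comes after a predecessor; the order of discovery also decides which vertex is last, where
    [ord_max] puts the loop. *)
Definition explore k a b (ws : seq word) : seq word :=
  foldl (fun s c => if has (same_state k c) s then s else rcons s c) ws
    (flatten [seq [seq c <- convex_children k w | ~~ is_cut k a b w c] | w <- ws]).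

Local Open Scope classical_set_scope.
Local Open Scope ring_scope.
(* The key Z denotes int_scope here. *)
Delimit Scope Z_scope with BZ.

(** * Transfer matrices *)

Section TransferMatrix.
Variables (n : nat) (M : 'M[nat]_n.+1) (D : {poly rat}) (P : 'I_n.+1 -> {poly rat}).
Hypothesis D0 : D`_0 != 0.
Hypothesis PE : forall i, P i = D + 'X * \sum_j (M i j)%:R * P j.

(** By [PE] the vector of the P_i / D is mapped by I - xM to the all-ones vector, and I - xM is
    invertible because its determinant takes the value 1 at x = 0. *)
Lemma walk_gfE : walk_gf M = ratfun_frac (RatFun (P ord0) D).
Proof.
pose A0 : 'M[{poly rat}]_n.+1 := 1%:M - 'X *: map_mx (fun m => m%:R) M.
pose A := 1%:M - tofrac 'X *: map_mx (fun m => m%:R) M : 'M[{fraction {poly rat}}]_n.+1.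
have AE : A = map_mx (tofrac (R := {poly rat})) A0.
  by apply/matrixP => i j; rewrite !mxE rmorphB rmorphM /= !rmorph_nat.
have Dn0 : tofrac D != 0.
  by rewrite tofrac_eq0; apply: contraNneq D0 => ->; rewrite coef0.
have Au : A \in unitmx.
  rewrite unitmxE unitfE AE det_map_mx tofrac_eq0.
  apply/eqP => /(congr1 (horner_eval 0)); rewrite -det_map_mx.
  have -> : map_mx (horner_eval 0) A0 = 1%:M.
    apply/matrixP => i j; rewrite !mxE /horner_eval hornerD hornerN hornerM hornerX mul0r subr0.
    by rewrite hornerMn hornerC.
  by rewrite det1 /horner_eval horner0 => /eqP; rewrite oner_eq0.
pose y : 'cV[{fraction {poly rat}}]_n.+1 := \col_i (tofrac (P i) / tofrac D).
have Ay : A *m y = const_mx 1.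
  rewrite mulmxBl mul1mx -scalemxAl; apply/matrixP => i j; rewrite !mxE.
  rewrite -[RHS](mulfV Dn0) {1}PE rmorphD rmorphM rmorph_sum /= mulrDl -addrA.
  rewrite -[RHS]addr0; congr +%R; apply/eqP; rewrite subr_eq0 -mulrA; apply/eqP.
  congr *%R; rewrite mulr_suml; apply: eq_bigr => l _.
  by rewrite !mxE rmorphM rmorph_nat mulrA.
have := congr1 (fun x => (invmx A *m x) ord0 ord0) Ay.
rewrite mulKmx // !mxE /walk_gf -/A /ratfun_frac /= => ->.
by apply: eq_bigr => j _; rewrite !mxE mulr1.
Qed.

Fixpoint mx_walks m i : nat :=
  if m is m'.+1 then (\sum_j M i j * mx_walks m' j)%N else 1%N.

(** Coefficient m of D W_i = P_i, where W_i is the series of walk counts from i. Both sides obey the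
    recursion in m that [PE] gives. *)
Lemma conv_walks m i : \sum_(l < m.+1) D`_(m - l) * (mx_walks l i)%:R = (P i)`_m.
Proof.
elim: m i => [|m IH] i; rewrite PE coefD coefXM.
  by rewrite big_ord1 mulr1 subn0 eqxx addr0.
rewrite big_ord_recl /= mulr1 subn0; congr +%R.
rewrite coef_sum; under eq_bigr => l _.
  rewrite subSS natr_sum mulr_sumr; under eq_bigr do rewrite natrM mulrCA.
  over.
rewrite exchange_big /=; apply: eq_bigr => j _.
by rewrite -mulr_sumr IH !mulr_natl coefMn.
Qed.

(** Both sequences have the same convolution with [D], which determines them one term at a time as
    D_0 is nonzero. *)
Lemma series_coef_walks m i : series_coef (RatFun (P i) D) m = (mx_walks m i)%:R.
Proof.
elim/ltn_ind: m => m IH.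
have := @series_coefP (RatFun (P i) D) m D0.
rewrite -[RHS]conv_walks !big_ord_recr /= subnn => /eqP.
rewrite (eq_bigr (fun l : 'I_m => D`_(m - l) * (mx_walks l i)%:R)); last first.
  by move=> l _; rewrite IH.
by rewrite (inj_eq (addrI _)) => /eqP/(mulfI D0).
Qed.

(** * Exponential growth of walk counts *)

Section Growth.
(* The sign [sg] allows D(0) < 0, for which all P_i(r) are negative. *)
Variables (R : realType) (r sg : R).
Let y i := sg * (map_poly ratr (P i)).[r].
Hypothesis r0 : 0 < r.
Hypothesis Dr : root (map_poly ratr D) r.
Hypothesis y0 : forall i, 0 < y i.

Let b := 1 / r.

Let b0 : 0 < b. Proof. by rewrite divr_gt0. Qed.

Let perron i : \sum_j (M i j)%:R * y j = b * y i.
Proof.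
rewrite /y PE rmorphD rmorphM rmorph_sum /= map_polyX hornerD (eqP Dr) add0r.
rewrite hornerM hornerX horner_sum /b div1r mulrCA mulKf ?gt_eqF // mulr_sumr.
apply: eq_bigr => j _.
by rewrite !mulr_natl rmorphMn hornerMn mulrnAr.
Qed.

(** The all-ones vector of walks of length 0 lies between two multiples of the positive eigenvector
    [y], and multiplying by the nonnegative matrix M preserves both inequalities. *)
Let walks_bounds m i :
  (1 + \sum_j y j)^-1 * y i * b ^+ m <= (mx_walks m i)%:R <=
    (\sum_j (y j)^-1) * y i * b ^+ m.
Proof.
have ysum j : y j <= \sum_l y l.
  by rewrite (bigD1 j) //= lerDl sumr_ge0 // => l _; apply: ltW.
have y1 : 0 < 1 + \sum_j y j by rewrite ltr_pwDl // sumr_ge0 // => j _; apply: ltW.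
elim: m i => [|m IH] i.
  rewrite expr0 !mulr1 /=; apply/andP; split.
    by rewrite mulrC ler_pdivrMr // mul1r (le_trans (ysum i)) // lerDr.
  rewrite -ler_pdivrMr // div1r (bigD1 i) //= lerDl.
  by rewrite sumr_ge0 // => l _; rewrite invr_ge0 ltW.
have yE C : C * y i * b ^+ m.+1 = C * (b * y i) * b ^+ m by rewrite exprS; ring.
have yM C j : C * ((M i j)%:R * y j) * b ^+ m = (M i j)%:R * (C * y j * b ^+ m).
  by move: (y j) (b ^+ m) => u v; ring.
rewrite [mx_walks _ _]/= natr_sum !yE -!perron !mulr_sumr !mulr_suml.
apply/andP; split; apply: ler_sum => j _; have /andP[h1 h2] := IH j.
  by rewrite yM natrM ler_wpM2l.
by rewrite yM natrM ler_wpM2l.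
Qed.

Lemma exp_growth_walks : exp_growth (RatFun (P ord0) D) b.
Proof.
apply/asboolP.
(* The factor 2 and the division by [b ^+ 2] come from f(n) = 2 [x^(n - 2)] F(x). *)
exists (2 * (1 + \sum_j y j)^-1 * y ord0 / b ^+ 2,
        2 * (\sum_j (y j)^-1) * y ord0 / b ^+ 2) => /=.
  have ge0 : 0 <= \sum_j y j by rewrite sumr_ge0 // => l _; apply: ltW.
  have gt0 : 0 < \sum_j (y j)^-1.
    rewrite (bigD1 ord0) //= ltr_pwDl ?invr_gt0 //.
    by rewrite sumr_ge0 // => l _; rewrite invr_ge0 ltW.
  have b2 := exprn_gt0 2 b0.
  have c1 : 0 < (1 + \sum_j y j)^-1 by rewrite invr_gt0 ltr_pwDl.
  by apply/andP; split; apply: divr_gt0 => //; apply: mulr_gt0 => //; apply: mulr_gt0.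
near=> m; have m2 : (2 <= m)%N by near: m; exists 2%N.
rewrite /counting_seq series_coef_walks rmorphM /= !rmorph_nat.
rewrite !ger0_norm ?mulr_ge0 ?exprn_ge0 ?ler0n ?(ltW b0) //.
have /andP[h1 h2] := walks_bounds (m - 2) ord0.
have bE c : 2 * c * y ord0 / b ^+ 2 * b ^+ m = 2 * (c * y ord0 * b ^+ (m - 2)).
  rewrite -{1}(subnK m2) exprD; field.
  by rewrite gt_eqF.
by rewrite !bE !ler_pM2l.
Unshelve. all: by end_near. Qed.

(** From [t] on, [g] is at most a multiple of [lam ^+ m], while walks number at least a multiple of
    (1/r)^m; the quotient (lam r)^m tends to 0. *)
Lemma walks_dominate (g : nat -> nat) (lam : R) t :
  0 < lam -> lam * r < 1 ->
  (forall m, (t <= m)%N -> (g m.+1)%:R <= lam * (g m)%:R) ->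
  \forall m \near \oo, (g m < mx_walks m ord0)%N.
Proof.
move=> lam0 lamr gS; set c := (1 + \sum_j y j)^-1 * y ord0.
have c0 : 0 < c.
  rewrite mulr_gt0 // invr_gt0 ltr_pwDl // sumr_ge0 // => l _; exact: ltW.
have gb m : (g (m + t)%N)%:R <= (g t)%:R * lam ^+ m.
  elim: m => [|m IH]; first by rewrite expr0 mulr1 add0n.
  rewrite addSn (le_trans (gS _ (leq_addl _ _))) // exprS mulrCA.
  by rewrite ler_pM2l.
have cv : (g t)%:R * (lam * r) ^+ m @[m --> \oo] --> (0 : R^o).
  rewrite -(mulr0 (g t)%:R); apply: cvgZr; apply: cvg_expr.
  by rewrite ger0_norm ?mulr_ge0 ?ltW.
have [N _ HN] : \forall m \near \oo, (g t)%:R * (lam * r) ^+ m < c * b ^+ t.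
  by apply: (cvgr_lt _ cv); rewrite mulr_gt0 // exprn_gt0.
exists (N + t)%N => //= m tm; rewrite -(ltr_nat R).
have mE : m = (m - t + t)%N by rewrite subnK // (leq_trans (leq_addl _ _) tm).
have /andP[lo _] := walks_bounds m ord0.
apply: lt_le_trans lo; rewrite -/c [X in g X]mE (le_lt_trans (gb _)) //.
have := HN (m - t)%N; rewrite /= leq_subRL; last by rewrite (leq_trans (leq_addl _ _) tm).
rewrite addnC => /(_ tm); rewrite [X in _ -> _ < _ * _ ^+ X]mE exprD => h.
have rb k : lam ^+ k = (lam * r) ^+ k * b ^+ k.
  by rewrite -exprMn /b -mulrA mulrA div1r mulrK ?unitfE ?gt_eqF.
by rewrite rb mulrA [b ^+ (m - t) * _]mulrC mulrA ltr_pM2r // exprn_gt0.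
Qed.

End Growth.
End TransferMatrix.

(** * Certified numerics *)

(** Certificates are computed with the binary integers [Z]; this transports them to any ring. *)
Definition ofZ {F : pzRingType} (z : Z) : F := (int_of_Z z)%:~R.

Section OfZ.
Variable F : pzRingType.

Lemma ofZD x y : ofZ (x + y)%BZ = ofZ x + ofZ y :> F.
Proof. by rewrite /ofZ -rmorphD -[int_of_Z x + _]rmorphD. Qed.

Lemma ofZM x y : ofZ (x * y)%BZ = ofZ x * ofZ y :> F.
Proof. by rewrite /ofZ -rmorphM -[int_of_Z x * _]rmorphM. Qed.

Lemma ofZN x : ofZ (- x)%BZ = - ofZ x :> F.
Proof. by rewrite /ofZ -rmorphN -[- int_of_Z x]rmorphN. Qed.

Lemma ofZB x y : ofZ (x - y)%BZ = ofZ x - ofZ y :> F.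
Proof. by rewrite -Z.add_opp_r ofZD ofZN. Qed.

End OfZ.

Lemma ler_ofZ (F : numDomainType) x y : (ofZ x <= ofZ y :> F) = (x <=? y)%BZ.
Proof. by rewrite /ofZ ler_int; lia. Qed.

Lemma ltr_ofZ (F : numDomainType) x y : (ofZ x < ofZ y :> F) = (x <? y)%BZ.
Proof. by rewrite /ofZ ltr_int; lia. Qed.

Lemma ofZ0 (F : pzRingType) : ofZ 0%BZ = 0 :> F. Proof. by []. Qed.

Lemma ofZ1 (F : pzRingType) : ofZ 1%BZ = 1 :> F. Proof. by []. Qed.

(** * Polynomials as lists of integer coefficients *)

Section PolyZ.
Variable F : nzRingType.

Definition polyZ (s : seq Z) : {poly F} := Poly (map ofZ s).

Fixpoint addZ (s t : seq Z) : seq Z :=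
  match s, t with
  | [::], _ => t
  | _, [::] => s
  | x :: s', y :: t' => (x + y)%BZ :: addZ s' t'
  end.

Definition oppZ := map Z.opp.

Lemma polyZ_cons x s : polyZ (x :: s) = (ofZ x)%:P + 'X * polyZ s.
Proof. by rewrite /polyZ /= cons_poly_def addrC commr_polyX. Qed.

Lemma polyZ_nil : polyZ [::] = 0. Proof. by []. Qed.

Lemma polyZ_add s t : polyZ (addZ s t) = polyZ s + polyZ t.
Proof.
elim: s t => [|x s IH] [|y t]; rewrite ?polyZ_nil ?add0r ?addr0 //=.
by rewrite !polyZ_cons IH ofZD polyCD mulrDr addrACA.
Qed.

Lemma polyZ_opp s : polyZ (oppZ s) = - polyZ s.
Proof.
elim: s => [|x s IH]; rewrite ?polyZ_nil ?oppr0 //=.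
by rewrite !polyZ_cons IH ofZN polyCN mulrN opprD.
Qed.

Lemma polyZ_eq s t : all (Z.eqb 0) (addZ s (oppZ t)) -> polyZ s = polyZ t.
Proof.
move=> H; apply/eqP; rewrite -subr_eq0 -polyZ_opp -polyZ_add; apply/eqP.
elim: (addZ _ _) H => //= x l IH /andP[x0 /IH e].
have -> : x = 0%BZ by case: x x0.
by rewrite polyZ_cons e mulr0 addr0.
Qed.

Lemma coef_polyZ s i : (polyZ s)`_i = ofZ (nth 0%BZ s i).
Proof.
rewrite coef_Poly; case: (ltnP i (size s)) => h; first exact: nth_map.
by rewrite !nth_default ?size_map.
Qed.

End PolyZ.

Lemma map_ratr_polyZ (F : numFieldType) s :
  map_poly ratr (polyZ rat s) = polyZ F s.
Proof.
by apply/polyP => i; rewrite coef_map !coef_polyZ /ofZ /= ratr_int.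
Qed.

(** * Positivity on intervals with rational ends *)

Section Interval.
Variable R : realFieldType.

(* [homog p q s] is the pair of q^d s(p/q) and q^d with d = size s. *)
Fixpoint homog (p q : Z) (s : seq Z) : Z * Z :=
  if s is c :: s' then
    let: (v, e) := homog p q s' in ((c * (q * e) + p * v)%BZ, (q * e)%BZ)
  else (0%BZ, 1%BZ).

(* Splitting s by the sign of its coefficients, s is bounded below on
   [p/q, p'/q] by its positive part at p/q minus its negative part at p'/q. *)
Definition positive_on (p p' q : Z) (s : seq Z) : bool :=
  ((homog p' q (map (fun c => Z.max 0 (- c)) s)).1 <?
   (homog p q (map (Z.max 0) s)).1)%BZ.

Lemma homogE p q s : (0 < q)%BZ ->
  let: (v, e) := homog p q s in
  0 < ofZ e :> R /\ ofZ v = ofZ e * (polyZ R s).[ofZ p / ofZ q].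
Proof.
move=> q0; have Q0 : 0 < ofZ q :> R by rewrite -(ofZ0 R) ltr_ofZ; lia.
elim: s => [|c s /=]; first by rewrite /= polyZ_nil horner0 mulr0 ofZ0 ofZ1.
case: (homog p q s) => v e [e0 ve].
rewrite !ofZM !ofZD !ofZM mulr_gt0 //; split=> //.
rewrite {}ve polyZ_cons hornerD hornerC hornerM hornerX.
set X := _.[_]; move: X (ofZ c) (ofZ e) e0 (ofZ p) (ofZ q) Q0 => X C E E0 A B B0; field.
by rewrite gt_eqF.
Qed.

(** The common denominator depends only on [q] and the length, which allows [positive_on] to compare
    numerators alone. *)
Lemma homog_snd p q s t : size s = size t -> (homog p q s).2 = (homog p q t).2.
Proof.
elim: s t => [|c s IH] [|d t] //= [/IH].
by case: (homog p q s) => v e; case: (homog p q t) => v' e' /= ->.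
Qed.

Lemma homog_snd_pt p p' q s : (homog p q s).2 = (homog p' q s).2.
Proof.
by elim: s => //= c s; case: (homog p q s) => v e; case: (homog p' q s) => v' e' /= ->.
Qed.

Lemma polyZ_ge0 s (x : R) : 0 <= x -> all (Z.leb 0) s -> 0 <= (polyZ R s).[x].
Proof.
move=> x0; elim: s => [|c s IH] /=; first by rewrite polyZ_nil horner0.
move=> /andP[c0 /IH h]; rewrite polyZ_cons !hornerE addr_ge0 ?mulr_ge0 //.
by rewrite -(ofZ0 R) ler_ofZ.
Qed.

Lemma polyZ_mono s (x y : R) : 0 <= x <= y -> all (Z.leb 0) s ->
  (polyZ R s).[x] <= (polyZ R s).[y].
Proof.
move=> /andP[x0 xy]; elim: s => [|c s IH] /=; first by rewrite polyZ_nil !horner0.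
move=> /andP[c0 cs]; rewrite !polyZ_cons !hornerE lerD2l.
by rewrite ler_pM ?IH ?polyZ_ge0.
Qed.

Lemma positive_onP p p' q s (x : R) : (0 <= p)%BZ -> (0 < q)%BZ ->
  ofZ p / ofZ q <= x <= ofZ p' / ofZ q -> positive_on p p' q s ->
  0 < (polyZ R s).[x].
Proof.
move=> p0 q0 /andP[px xp'].
have Q0 : 0 < ofZ q :> R by rewrite -(ofZ0 R) ltr_ofZ; lia.
have P0 : 0 <= ofZ p / ofZ q :> R.
  by rewrite divr_ge0 ?(ltW Q0) // -(ofZ0 R) ler_ofZ; lia.
rewrite /positive_on; set sp := map (Z.max 0) s; set sn := map _ s.
have -> : polyZ R s = polyZ R sp - polyZ R sn.
  rewrite /sp /sn; elim: s {sp sn} => [|c s IH]; first by rewrite !polyZ_nil subr0.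
  rewrite [map _ _]/= [in X in _ - X]/= !polyZ_cons IH.
  rewrite [in LHS](_ : c = Z.max 0 c - Z.max 0 (- c))%BZ; last by lia.
  by rewrite ofZB polyCB; ring.
have ap : all (Z.leb 0) sp by rewrite all_map; apply/allP => c _ /=; lia.
have an : all (Z.leb 0) sn by rewrite all_map; apply/allP => c _ /=; lia.
have := homogE p sp q0; have := homogE p' sn q0.
have : (homog p' q sn).2 = (homog p q sp).2.
  by rewrite (homog_snd_pt p' p); apply: homog_snd; rewrite !size_map.
case: (homog p q sp) => v e; case: (homog p' q sn) => v' e' /= -> [e0 ve'] [_ ve].
rewrite -(ltr_ofZ R) ve ve' ltr_pM2l // hornerD hornerN subr_gt0 => lt.
have h1 : (polyZ R sn).[x] <= (polyZ R sn).[ofZ p' / ofZ q].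
  by apply: polyZ_mono; rewrite ?xp' ?(le_trans P0).
have h2 : (polyZ R sp).[ofZ p / ofZ q] <= (polyZ R sp).[x].
  by apply: polyZ_mono; rewrite ?px ?P0.
exact: le_lt_trans h1 (lt_le_trans lt h2).
Qed.

End Interval.

Lemma polyZ_root (R : rcfType) p p' q s : (0 <= p <= p')%BZ -> (0 < q)%BZ ->
  positive_on p p q s -> positive_on p' p' q (oppZ s) ->
  exists2 r : R, ofZ p / ofZ q <= r <= ofZ p' / ofZ q & root (polyZ R s) r.
Proof.
move=> [p0 pp'] q0 pp np.
have Q0 : 0 < ofZ q :> R by rewrite -(ofZ0 R) ltr_ofZ; lia.
have le : ofZ p / ofZ q <= ofZ p' / ofZ q :> R.
  by rewrite ler_pM2r ?invr_gt0 // ler_ofZ; lia.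
(* The sign is flipped since [poly_ivt] asks for a nonpositive value at the left end and a
   nonnegative one at the right. *)
have [r rin rr] : exists2 r : R,
    r \in `[ofZ p / ofZ q, ofZ p' / ofZ q] & root (polyZ R (oppZ s)) r.
  apply: poly_ivt => //; apply/andP; split.
    rewrite polyZ_opp hornerN oppr_le0 ltW //.
    by apply: positive_onP pp; rewrite ?lexx.
  by rewrite ltW //; apply: positive_onP np; rewrite ?lexx //; lia.
by exists r => //; rewrite polyZ_opp rootN in rr.
Qed.

(** * Rounded decimals *)

Definition digits (a : nat) (ds : seq nat) : Z :=
  foldl (fun x d => (10 * x + Z.of_nat d)%BZ) (Z.of_nat a) ds.

Lemma ofZ_nat (F : pzRingType) m : ofZ (Z.of_nat m) = m%:R :> F.
Proof. by rewrite /ofZ -[in RHS]mulrz_nat; congr intmul; lia. Qed.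

Lemma decimalE (R : realType) a ds :
  decimal R a ds = ofZ (digits a ds) / 10 ^+ size ds.
Proof.
elim/last_ind: ds => [|ds d IH].
  by rewrite /decimal big_ord0 addr0 expr0 divr1 ofZ_nat.
rewrite /digits foldl_rcons ofZD ofZM ofZ_nat -/(digits a ds).
have -> : decimal R a (rcons ds d) = decimal R a ds + d%:R / 10 ^+ (size ds).+1.
  rewrite /decimal size_rcons big_ord_recr /= nth_rcons ltnn eqxx addrA.
  congr (_ + _ + _); apply: eq_bigr => i _.
  by rewrite nth_rcons ltn_ord.
rewrite IH size_rcons exprS (_ : ofZ 10 = 10) //; field.
by rewrite expf_neq0 // pnatr_eq0.
Qed.

Lemma ofZ_pow10 (F : pzRingType) m : ofZ (10 ^ Z.of_nat m)%BZ = 10 ^+ m :> F.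
Proof.
elim: m => [|m IH]; first by rewrite expr0.
by rewrite exprS -IH Nat2Z.inj_succ Z.pow_succ_r ?ofZM; last lia.
Qed.

(** The condition |x - A/t| < 1/(2t), with t a power of ten and A the integer of the digits, at the
    extreme values p/q and p'/q' of x and cleared of denominators. *)
Definition rounds_check (p p' q q' : Z) a ds : bool :=
  let t := (10 ^ Z.of_nat (size ds))%BZ in
  ((2 * (p' * t - digits a ds * q') <? q') && (2 * (digits a ds * q - p * t) <? q))%BZ.

Lemma rounds_checkP (R : realType) p p' q q' a ds (x : R) :
  (0 < q)%BZ -> (0 < q')%BZ ->
  ofZ p / ofZ q <= x -> x <= ofZ p' / ofZ q' -> rounds_check p p' q q' a ds ->
  rounds_to x a ds.
Proof.
move=> q0 q0' px xp' /andP[]; rewrite -!(ltr_ofZ R) !(ofZM, ofZB) ofZ_pow10.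
have Q0 : 0 < ofZ q :> R by rewrite -(ofZ0 R) ltr_ofZ; lia.
have Q0' : 0 < ofZ q' :> R by rewrite -(ofZ0 R) ltr_ofZ; lia.
rewrite (_ : ofZ 2 = 2) // /rounds_to decimalE.
move: px xp'; rewrite ler_pdivrMr // ler_pdivlMr //.
have : 0 < 10 ^+ size ds :> R by rewrite exprn_gt0.
move: (10 ^+ _) (ofZ (digits _ _)) => t A t0 px xp' h1 h2.
have -> : t^-1 / 2 = (1 / 2) / t :> R by field; rewrite gt_eqF.
have -> : x - A / t = (x * t - A) / t by field; rewrite gt_eqF.
rewrite normrM (gtr0_norm (x := t^-1)) ?invr_gt0 // ltr_pM2r ?invr_gt0 //.
rewrite ltr_norml; apply/andP; split.
  rewrite -(ltr_pM2r Q0); nra.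
rewrite -(ltr_pM2r Q0'); nra.
Qed.

(** * Uniqueness of the minimal root *)

Lemma sum_by_parts (C : comNzRingType) (a : nat -> C) w d :
  \sum_(i < d.+1) a i * w ^+ i =
  (1 - w) * (\sum_(k < d) (\sum_(i < k.+1) a i) * w ^+ k) +
  (\sum_(i < d.+1) a i) * w ^+ d.
Proof.
elim: d => [|d IH]; first by rewrite big_ord0 !big_ord1 mulr0 add0r.
rewrite big_ord_recr IH [X in _ = _ * X + _]big_ord_recr.
rewrite [X in _ = _ + X * _]big_ord_recr exprS /=; ring.
Qed.

(** As the full sum of [a] vanishes, summation by parts splits off the factor 1 - w. If the other
    factor vanished, S_0 would be minus the sum of S_k w^k over k >= 1, too small in modulus when
    |w| <= 1. *)
Lemma dominant_partial_sum (C : numFieldType) (a : nat -> C) (w : C) d :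
  \sum_(i < d.+2) a i = 0 -> \sum_(i < d.+2) a i * w ^+ i = 0 -> `|w| <= 1 ->
  \sum_(k < d) `|\sum_(i < k.+2) a i| < `|a 0%N| -> w = 1.
Proof.
move=> a1; rewrite sum_by_parts a1 mul0r addr0 => /eqP; rewrite mulf_eq0.
case/orP => [/eqP e|/eqP aw] w1 dom.
  by apply/eqP; rewrite eq_sym -subr_eq0 e.
suff : `|a 0%N| <= \sum_(k < d) `|\sum_(i < k.+2) a i|.
  by move/le_lt_trans/(_ dom); rewrite ltxx.
move: aw; rewrite big_ord_recl big_ord1 expr0 mulr1 => /eqP; rewrite addr_eq0 => /eqP ->.
rewrite normrN (le_trans (ler_norm_sum _ _ _)) // ler_sum // => k _.
rewrite normrM normrX ler_piMr ?normr_ge0 //.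
by rewrite exprn_ile1.
Qed.

Lemma horner_polyZ (F : nzRingType) s k (x : F) :
  (polyZ F (take k s)).[x] = \sum_(i < k) ofZ (nth 0%BZ s i) * x ^+ i.
Proof.
rewrite (@horner_coef_wide _ k); last first.
  by rewrite (leq_trans (size_Poly _)) // size_map size_take_min geq_minl.
by apply: eq_bigr => i _; rewrite coef_polyZ nth_take.
Qed.

(** Meant to have the absolute value of [f] as its value; the sign is only guessed and needs a
    positivity check afterwards. *)
Definition absZ p p' q f := if positive_on p p' q f then f else oppZ f.

(** S_k is the truncation of [s] to k + 1 coefficients, evaluated at the root, so dominance of S_0
    becomes positivity of one polynomial on the bracket. The last partial sum is left out, being
    zero at the root. *)
Definition dominant_check p p' q s : bool :=
  let fs := [seq absZ p p' q (take k.+2 s) | k <- iota 0 (size s - 2)] in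
  [&& (1 < size s)%N, all (positive_on p p' q) fs &
      positive_on p p' q (addZ (absZ p p' q (take 1 s)) (oppZ (foldr addZ [::] fs)))].

Section Dominant.
Variables (R : realType) (p p' q : Z) (r : R).
Hypothesis p0 : (0 < p)%BZ.
Hypothesis q0 : (0 < q)%BZ.
Hypothesis rI : ofZ p / ofZ q <= r <= ofZ p' / ofZ q.

Lemma interval_gt0 : 0 < r.
Proof.
have /andP[h _] := rI; apply: lt_le_trans h.
by rewrite divr_gt0 // -(ofZ0 R) ltr_ofZ; lia.
Qed.

Let posP f : positive_on p p' q f -> 0 < (polyZ R f).[r].
Proof. by apply: positive_onP rI => //; lia. Qed.

Let absZ_norm f : positive_on p p' q (absZ p p' q f) ->
  (polyZ R (absZ p p' q f)).[r] = `|(polyZ R f).[r]|.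
Proof.
rewrite /absZ; case: ifP => [/posP f0 _|_ /posP]; first by rewrite gtr0_norm.
by rewrite polyZ_opp hornerN oppr_gt0 => /ltr0_norm ->.
Qed.

Let norm_real_complex (x : R) : `|x%:C%C| = (`|x|)%:C%C.
Proof. by rewrite normc_def /= expr0n addr0 sqrtr_sqr. Qed.

(** Holds whichever sign was guessed, which is enough for S_0 since only a lower bound on its
    modulus matters. *)
Lemma absZ_le f : (polyZ R (absZ p p' q f)).[r] <= `|(polyZ R f).[r]|.
Proof.
rewrite /absZ; case: ifP => _; first exact: ler_norm.
by rewrite polyZ_opp hornerN -normrN ler_norm.
Qed.

(** If |z| <= r, then [dominant_partial_sum] for w = z/r and the coefficients s_i r^i forces z =
    r. *)
Lemma unique_minimal_rootP s : root (polyZ R s) r -> dominant_check p p' q s ->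
  forall z : R[i], root (polyZ R[i] s) z -> z != r%:C%C -> `|r%:C%C| < `|z|.
Proof.
case: s => [|c0 [|c1 s]] // rr /and3P[_ pos dom] z rz zr.
have r0 := interval_gt0.
have rC0 : r%:C%C != 0 :> R[i] by rewrite eq_complex /= eqxx andbT gt_eqF.
set t := [:: c0, c1 & s] in rr pos dom rz.
pose a i := ofZ (nth 0%BZ t i) * r ^+ i.
have aE k : (polyZ R (take k t)).[r] = \sum_(i < k) a i by apply: horner_polyZ.
rewrite real_ltNge ?normr_real //; apply/negP => zle.
have /eqP[] : z != r%:C%C by [].
suff : z / r%:C%C = 1 by move/divr1_eq.
apply: (@dominant_partial_sum _ (fun i => (a i)%:C%C) _ (size s)).
- rewrite -rmorph_sum /= -aE take_oversize //.
  by move: rr; rewrite rootE => /eqP ->.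
- move: rz; rewrite rootE -[t](@take_oversize _ (size t)) // horner_polyZ => /eqP e.
  rewrite -[RHS]e; apply: eq_bigr => i _.
  rewrite /a rmorphM rmorphXn /= /ofZ rmorph_int -mulrA -exprMn.
  by rewrite mulrCA mulfV ?mulr1.
- by rewrite normf_div ler_pdivrMr ?mul1r // normr_gt0.
rewrite (eq_bigr (fun k : 'I_(size s) => (`|\sum_(i < k.+2) a i|)%:C%C)); last first.
  by move=> k _; rewrite -rmorph_sum /= norm_real_complex.
rewrite -rmorph_sum /= norm_real_complex ltcR.
have -> : a 0%N = (polyZ R (take 1 t)).[r] by rewrite aE big_ord1.
apply: lt_le_trans (absZ_le _).
move/posP: dom; rewrite polyZ_add polyZ_opp hornerD hornerN subr_gt0.
move=> h; apply: le_lt_trans h; rewrite le_eqVlt; apply/orP; left; apply/eqP.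
have FE k : positive_on p p' q (absZ p p' q (take k.+2 t)) ->
    (polyZ R (absZ p p' q (take k.+2 t))).[r] = `|\sum_(i < k.+2) a i|.
  by move=> /absZ_norm ->; rewrite aE.
rewrite -(big_mkord xpredT (fun k => `|\sum_(i < k.+2) a i|)) /index_iota subn0.
move: pos; rewrite [size t]/= !subSS subn0.
elim: (iota 0 (size s)) => [|k l IH] /=.
  by rewrite big_nil polyZ_nil horner0.
move=> /andP[pk /IH e]; rewrite big_cons polyZ_add hornerD e.
by congr +%R; apply/esym/FE.
Qed.

End Dominant.

(** * Dominant roots and walk counts *)

Definition loop_at l (nb : seq (seq nat)) :=
  mkseq (fun i => if i == l then l :: nth [::] nb i else nth [::] nb i) (size nb).

Definition transfer_step D nb (P : seq (seq Z)) :=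
  [seq addZ D (0%BZ :: foldr addZ [::] [seq nth [::] P j | j <- l]) | l <- nb].

(* Iterating the step from 0 modulo x^d reaches its polynomial fixed point of
   degree < d. *)
Definition transfer_polys d D nb :=
  iter d (fun P => map (take d) (transfer_step D nb P)) (nseq (size nb) [::]).

(** The fixed-point equation is tested without truncation, so any list [P] passing the test will do,
    however it was found. *)
Definition transfer_check D nb P :=
  all (fun i => all (Z.eqb 0)
    (addZ (nth [::] P i) (oppZ (nth [::] (transfer_step D nb P) i)))) (iota 0 (size nb)).

Definition mulZ (s t : seq Z) :=
  foldr (fun c acc => addZ (map (Z.mul c) t) (0%BZ :: acc)) [::] s.

Lemma polyZ_mul (F : comNzRingType) s t : polyZ F (mulZ s t) = polyZ F s * polyZ F t.
Proof.
elim: s => [|c s IH]; first by rewrite /= !polyZ_nil mul0r.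
rewrite [mulZ _ _]/= polyZ_add !polyZ_cons -/(mulZ s t) IH ofZ0 add0r mulrDl mulrA.
congr (_ + _); elim: t {IH} => [|x t IH]; first by rewrite !polyZ_nil mulr0.
by rewrite [map _ _]/= !polyZ_cons IH ofZM polyCM; ring.
Qed.

Lemma big_count_mem (V : pzSemiRingType) n (l : seq nat) (F : nat -> V) :
  all (fun j => (j < n)%N) l ->
  \sum_(j < n) (count_mem (j : nat) l)%:R * F j = \sum_(j <- l) F j.
Proof.
elim: l => [_|x l IH /= /andP[xn /IH e]].
  by rewrite big_nil big1 // => j _; rewrite mul0r.
rewrite big_cons -e; under eq_bigr do rewrite natrD mulrDl.
rewrite big_split /=; congr +%R; rewrite (bigD1 (Ordinal xn)) //= eqxx mul1r.
rewrite big1 ?addr0 // => j /negP jx; rewrite (_ : (x == j) = false) ?mul0r //.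
by apply/negP => /eqP e'; apply: jx; apply/eqP/val_inj.
Qed.

Section Digraph.
Variables (n : nat) (nb : seq (seq nat)).
Hypothesis size_nb : size nb = n.+1.
Hypothesis rng : all (all (fun j => j < n.+1)%N) nb.

Let rng_nth i : all (fun j => j < n.+1)%N (nth [::] nb i).
Proof.
case: (ltnP i (size nb)) => h; first by apply: (allP rng); apply: mem_nth.
by rewrite nth_default.
Qed.

Lemma mx_walksE m i : mx_walks (count_mx n.+1 nb) m i = walks nb m i.
Proof.
elim: m i => //= m IH i; rewrite sumnE big_map -(big_count_mem _ (rng_nth i)).
by apply: eq_bigr => j _; rewrite mxE IH natn.
Qed.

Lemma add_loop_count_mx :
  add_loop ord_max (count_mx n.+1 nb) = count_mx n.+1 (loop_at n nb).
Proof.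
apply/matrixP => i j; rewrite !mxE nth_mkseq ?size_nb //.
have -> : (i == ord_max) = (nat_of_ord i == n) by [].
have -> : (j == ord_max) = (nat_of_ord j == n) by [].
by case: eqP => _ /=; rewrite ?addn0 // addnC [n == _]eq_sym.
Qed.

Lemma transferP D P : transfer_check D nb P -> forall i : 'I_n.+1,
  polyZ rat (nth [::] P i) = polyZ rat D +
    'X * \sum_j ((count_mx n.+1 nb) i j)%:R * polyZ rat (nth [::] P j).
Proof.
move=> /allP chk i; have iR : (i < size nb)%N by rewrite size_nb.
have := chk i; rewrite mem_iota => /(_ iR)/(polyZ_eq rat) ->.
rewrite (nth_map [::]) // polyZ_add polyZ_cons ofZ0 add0r; congr (_ + _ * _).
under eq_bigr do rewrite mxE.
rewrite (big_count_mem (fun j => polyZ rat (nth [::] P j))) //.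
elim: (nth [::] nb i) => [|x l IH] /=; first by rewrite big_nil polyZ_nil.
by rewrite polyZ_add big_cons IH.
Qed.

End Digraph.

Lemma root_mulZ (F : comNzRingType) s t (x : F) :
  root (polyZ F s) x -> root (polyZ F (mulZ s t)) x.
Proof. by rewrite !rootE polyZ_mul hornerM => /eqP ->; rewrite mul0r. Qed.

Section Analysis.
Variables (n : nat) (nb : seq (seq nat)) (D : seq Z) (P : seq (seq Z)).
(* The factor [G] is free to choose: multiplying D by it may make the partial
   sums of [dominant_check] small enough. *)
Variables (G : seq Z) (p p' q : Z).
(* A coarser bracket [c/d, c'/d], cheaper to compute with. *)
Variables (c c' d : Z).

(* The paper's F_1 has denominator with constant coefficient -1. *)
Definition normalize (f : seq Z) := if (nth 0 D 0 <? 0)%BZ then oppZ f else f.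

(** On an interval reduced to a point [positive_on] is a sign evaluation; two of them give the sign
    change of D that locates the root. *)
Definition analysis_check :=
  [&& size nb == n.+1, all (all (fun j => j < n.+1)%N) nb,
      transfer_check D nb P, (0 <? p)%BZ, (p <=? p')%BZ, (0 <? q)%BZ &
      ~~ (nth 0 D 0 =? 0)%BZ] &&
  [&& positive_on p p q (normalize D), positive_on p' p' q (oppZ (normalize D)),
      dominant_check c c' d (mulZ D G),
      all (fun i => positive_on c c' d (normalize (nth [::] P i))) (iota 0 n.+1) &
      [&& 0 <? c, 0 <? d, c * q <=? p * d & p' * d <=? c' * q]%BZ].

Hypothesis check : analysis_check.
Variable F : ratfun.
Hypothesis numF : Defs.num F = polyZ rat (nth [::] P 0).
Hypothesis denF : den F = polyZ rat D.

Let FE : F = RatFun (polyZ rat (nth [::] P (@ord0 n))) (polyZ rat D).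
Proof. by rewrite -denF -numF; case: F. Qed.

Let D0 : (polyZ rat D)`_0 != 0.
Proof.
case/andP: check => /and5P[_ _ _ _ /and3P[_ _ d0]] _.
rewrite coef_polyZ /ofZ intr_eq0; lia.
Qed.

Let size_nb : size nb = n.+1.
Proof. by case/andP: check => /andP[/eqP]. Qed.
Let rng : all (all (fun j => j < n.+1)%N) nb.
Proof. by case/andP: check => /and3P[]. Qed.
Let PE : forall i : 'I_n.+1,
  polyZ rat (nth [::] P i) = polyZ rat D +
    'X * \sum_j ((count_mx n.+1 nb) i j)%:R * polyZ rat (nth [::] P j).
Proof. by apply: transferP => //; case/andP: check => /and4P[]. Qed.

Lemma walk_gf_count_mx : walk_gf (count_mx n.+1 nb) = ratfun_frac F.
Proof.
rewrite FE.
exact: (@walk_gfE n _ _ (fun i : 'I_n.+1 => polyZ rat (nth [::] P i)) D0 PE).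
Qed.

Lemma counting_seqE m : counting_seq F m.+2 = 2 * (walks nb m 0)%:R.
Proof.
rewrite /counting_seq FE subSS subSS subn0.
rewrite (@series_coef_walks n _ _ (fun i : 'I_n.+1 => polyZ rat (nth [::] P i)) D0 PE).
by rewrite mx_walksE.
Qed.

Variable R : realType.

Definition dominant_root_facts (r : R) :=
  [/\ ofZ p / ofZ q <= r <= ofZ p' / ofZ q,
      unique_minimal_root (den F) r,
      exp_growth F (1 / r) &
      forall (g : nat -> nat) (lam : R) t, 0 < lam -> lam * r < 1 ->
        (forall m, (t <= m)%N -> (g m.+1)%:R <= lam * (g m)%:R) ->
        \forall m \near \oo, (g m < walks nb m 0)%N].

Lemma analysis : exists r, dominant_root_facts r.
Proof.
case/andP: check => /and5P[_ _ _ p0 /and3P[pp' q0 _]] /and5P[posl posr dom posP coarse].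
have [P0 P0' PP Q0] : [/\ (0 < p)%BZ, (0 <= p)%BZ, (0 <= p <= p')%BZ & (0 < q)%BZ].
  by clear -p0 pp' q0; split; lia.
have [r rI rr] := @polyZ_root R p p' q (normalize D) PP Q0 posl posr.
pose sg : R := if (nth 0 D 0 <? 0)%BZ then -1 else 1.
have normE f : polyZ R (normalize f) = sg%:P * polyZ R f.
  by rewrite /normalize /sg; case: ifP => _; rewrite ?polyZ_opp ?polyCN ?mulN1r ?mul1r.
have sg0 : sg != 0 by rewrite /sg; case: ifP => _; rewrite ?oppr_eq0 oner_eq0.
have rD : root (polyZ R D) r.
  by move: rr; rewrite normE rootM rootC (negbTE sg0).
have r0 : 0 < r by apply: interval_gt0 P0 Q0 rI.
have rD' : root (map_poly ratr (polyZ rat D)) r by rewrite map_ratr_polyZ.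
have [C0 C0' E0 cp pc] : [/\ (0 < c)%BZ, (0 <= c)%BZ, (0 < d)%BZ,
    (c * q <=? p * d)%BZ & (p' * d <=? c' * q)%BZ].
  by case/and4P: coarse; clear => *; split; lia.
have rC : ofZ c / ofZ d <= r <= ofZ c' / ofZ d.
  have Q0' : 0 < ofZ q :> R by rewrite -(ofZ0 R) ltr_ofZ; apply/Z.ltb_lt.
  have E0' : 0 < ofZ d :> R by rewrite -(ofZ0 R) ltr_ofZ; apply/Z.ltb_lt.
  case/andP: rI => h1 h2; apply/andP; split.
    apply: le_trans h1; rewrite ler_pdivrMr // mulrAC ler_pdivlMr //.
    by rewrite -!ofZM ler_ofZ.
  apply: le_trans h2 _; rewrite ler_pdivrMr // mulrAC ler_pdivlMr //.
  by rewrite -!ofZM ler_ofZ.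
have y0 (i : 'I_n.+1) : 0 < sg * (map_poly ratr (polyZ rat (nth [::] P i))).[r].
  rewrite map_ratr_polyZ -[sg](hornerC _ r) -hornerM -normE.
  apply: (positive_onP C0' E0 rC).
  by apply: (allP posP); rewrite mem_iota /= ltn_ord.
exists r; split => //.
- rewrite denF; split.
    rewrite map_ratr_polyZ; move: rD; rewrite !rootE -[_ r%:C%C](_ : ((polyZ R D).[r])%:C%C = _).
      by move=> /eqP ->.
    rewrite -horner_map /= (_ : map_poly _ _ = polyZ R[i] D) //.
    by apply/polyP => i; rewrite coef_map !coef_polyZ /ofZ /= rmorph_int.
  (* Multiplication by [G] can only add roots, so minimality among the roots of the product
     suffices. *)
  move=> z rz; apply: (unique_minimal_rootP C0 E0 rC (s := mulZ D G)) => //.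
    exact: root_mulZ.
  by apply: root_mulZ; rewrite map_ratr_polyZ in rz.
- rewrite FE.
  exact: (@exp_growth_walks n _ _ (fun i : 'I_n.+1 => polyZ rat (nth [::] P i)) D0 PE R r sg r0 rD' y0).
move=> g lam t l0 lr gS.
have := @walks_dominate n _ _ (fun i : 'I_n.+1 => polyZ rat (nth [::] P i)) PE R r sg r0 rD' y0 g lam t l0 lr gS.
by apply: filterS => m; rewrite mx_walksE.
Qed.

End Analysis.

(** The counts from all vertices are advanced together in binary, whereas evaluating [walks] would
    branch at every step and count in unary. *)
Definition binary_walks (nb : seq (seq nat)) t : seq Z :=
  iter t (fun h => [seq foldr Z.add 0%BZ [seq nth 0%BZ h j | j <- l] | l <- nb])
    (nseq (size nb) 1%BZ).

Definition ratio_check nb t a b :=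
  all (all (fun j => (j < size nb)%N)) nb &&
  all (fun i => (b * nth 0 (binary_walks nb t.+1) i <=? a * nth 0 (binary_walks nb t) i)%BZ)
    (iota 0 (size nb)).

Lemma binary_walksE nb t i : all (all (fun j => (j < size nb)%N)) nb ->
  (i < size nb)%N -> nth 0%BZ (binary_walks nb t) i = Z.of_nat (walks nb t i).
Proof.
move=> rng; elim: t i => [|t IH] i iR; first by rewrite nth_nseq iR.
rewrite (nth_map [::]) // -/(binary_walks nb t) /=.
have : all (fun j => (j < size nb)%N) (nth [::] nb i).
  by apply: (allP rng); apply: mem_nth.
elim: (nth [::] nb i) => //= j l IHl /andP[jR /IHl ->].
by rewrite IH //; lia.
Qed.

(** A Collatz-Wielandt bound: once the inequality holds at every vertex for length [t], summing it
    over neighbours gives all greater lengths. *)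
Lemma walks_ratio (R : realFieldType) nb t a b : (0 < a)%BZ -> (0 < b)%BZ ->
  ratio_check nb t a b -> forall m i, (t <= m)%N -> (i < size nb)%N ->
  (walks nb m.+1 i)%:R <= ofZ a / ofZ b * (walks nb m i)%:R :> R.
Proof.
move=> a0 b0 /andP[rng /allP chk] m i /subnK <-.
have B0 : 0 < ofZ b :> R by rewrite -(ofZ0 R) ltr_ofZ; lia.
elim: (m - t)%N i => {m} [|m IH] i iR.
  have := chk i; rewrite add0n mem_iota => /(_ iR).
  rewrite !binary_walksE // -(ler_ofZ R) !ofZM !ofZ_nat mulrAC ler_pdivlMr //.
  by rewrite mulrC.
rewrite addSn; set l' := (m + t)%N in IH *.
rewrite -[walks nb l'.+2 i]/(sumn _) -[walks nb l'.+1 i in leRHS]/(sumn _).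
have : all (fun j => (j < size nb)%N) (nth [::] nb i).
  by apply: (allP rng); apply: mem_nth.
elim: (nth [::] nb i) => [|j l IHl] /=; first by rewrite mulr0.
move=> /andP[jR /IHl h]; rewrite !natrD mulrDr lerD //.
exact: IH.
Qed.

(** * Walk counts against convex permutations *)

Section Comparison.
Variables (k : nat) (F : ratfun) (nb : seq (seq nat)).
Hypothesis k2 : (k <= 2)%N.
Hypothesis FE : forall m, counting_seq F m.+2 = 2 * (walks nb m 0)%:R.

Lemma counting_seq_lt :
  (\forall m \near \oo, walks nb m 0 < num_desc k m [:: 1; 2])%N ->
  \forall n \near \oo, counting_seq F n < (num_convex k n)%:R.
Proof.
case=> N _ HN; exists N.+2 => // -[|[|n]] //= Nn.
by rewrite FE num_convexE // natrM ltr_pM2l // ltr_nat; apply: HN.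
Qed.

Lemma counting_seq_gt :
  (\forall m \near \oo, num_desc k m [:: 1; 2] < walks nb m 0)%N ->
  \forall n \near \oo, (num_convex k n)%:R < counting_seq F n.
Proof.
case=> N _ HN; exists N.+2 => // -[|[|n]] //= Nn.
by rewrite FE num_convexE // natrM ltr_pM2l // ltr_nat; apply: HN.
Qed.

End Comparison.

Definition redirected k n ws := map (redirected_nbrs k (iota 1 n) (iota 1 n.+1) ws) ws.

Definition upper_check k n ws t a b :=
  [&& all (proper_convex k) ws, nth [::] ws 0 == [:: 1; 2]%N, (0 < size ws)%N, (1 < n)%N,
      ratio_check (redirected k n ws) t a b, (0 <? a)%BZ & (0 <? b)%BZ].

(** Descendants of 12 are bounded by walks in the redirected digraph, which eventually grow by a
    factor of at most a/b < q/p' <= 1/r per step, hence lose against the walks in [nb]. *)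
Lemma num_desc_lt_walks (R : realType) k n ws t a b nb (p p' q : Z) F (r : R) :
  upper_check k n ws t a b -> (0 < q)%BZ -> (a * p' < b * q)%BZ ->
  dominant_root_facts nb p p' q F r ->
  (\forall m \near \oo, num_desc k m [:: 1; 2] < walks nb m 0)%N.
Proof.
move=> /and5P[gws /eqP w0 ws0 n2 /and3P[ratio a0 b0]] q0 lt [/andP[_ rp'] _ _ dom].
have A0 : 0 < ofZ a :> R by rewrite -(ofZ0 R) ltr_ofZ.
have B0 : 0 < ofZ b :> R by rewrite -(ofZ0 R) ltr_ofZ.
have Q0 : 0 < ofZ q :> R by rewrite -(ofZ0 R) ltr_ofZ; clear -q0; lia.
have lamr : ofZ a / ofZ b * r < 1.
  apply: (@le_lt_trans _ _ (ofZ a / ofZ b * (ofZ p' / ofZ q))).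
    by rewrite ler_pM2l // divr_gt0.
  rewrite mulf_div ltr_pdivrMr ?mulr_gt0 // mul1r -!ofZM ltr_ofZ.
  by clear -lt; lia.
have szU : size (redirected k n ws) = size ws by rewrite size_map.
have [a0' b0'] : (0 < a)%BZ /\ (0 < b)%BZ by clear -a0 b0; lia.
have [N _ HN] := dom (fun m => walks (redirected k n ws) m 0) _ t
  (divr_gt0 A0 B0) lamr (fun m tm =>
    @walks_ratio R _ _ _ _ a0' b0' ratio m 0 tm
      ltac:(by rewrite szU)).
exists N => // m Nm; apply: leq_ltn_trans (HN m Nm); rewrite -{1}w0.
apply: num_desc_le_walks => //.
- exact: proper_convex_iota.
- exact: (@proper_convex_iota k n.+1 (ltnW n2)).
- by move: ratio => /andP[]; rewrite szU.
by move=> l; apply: num_desc_iota.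
Qed.

(** [s] leads from 12 to the vertex with the cut edge; every generation beyond its length has
    descendants across that edge. *)
Lemma walks_lt_num_desc k a b ws p i s : truncation_check k a b ws p ->
  (forall m, 0 < num_desc k m b)%N -> (0 < size ws)%N ->
  path (fun i j => (j < size ws)%N && (j \in kept_nbrs k a b ws (nth [::] ws i))) 0%N s ->
  (last 0%N s = i) -> (i < size ws)%N ->
  has (is_cut k a b (nth [::] ws i)) (convex_children k (nth [::] ws i)) ->
  (\forall m \near \oo, walks (map (kept_nbrs k a b ws) ws) m 0 < num_desc k m [:: 1; 2])%N.
Proof.
move=> chk b0 ws0 ps li iws /hasP[c ci cc].
have w0 : nth [::] ws 0 = [:: 1; 2]%N by case/and5P: chk => /and4P[_ _ _ /eqP].
exists (size s).+1 => // m sm; rewrite -w0.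
rewrite -(subnKC (ltnW sm)); apply: (walks_lt_path chk) => //.
rewrite li -(subnSK sm); exact: (walks_lt_cut chk) ci cc (b0 _).
Qed.

(** * Certificates for k = 1 and k = 2 *)

(** That 14 rounds of search exhaust the truncated digraph is certified by [truncation_check]. *)
Definition vertices1 := Eval vm_compute in
  iter 14 (explore 1 (iota 1 7) (iota 1 8)) [:: [:: 1; 2]%N].
Definition vertices2 := Eval vm_compute in
  iter 14 (explore 2 (iota 1 8) (iota 1 9)) [:: [:: 1; 2]%N].
Definition nbrs1 := Eval vm_compute in
  map (kept_nbrs 1 (iota 1 7) (iota 1 8) vertices1) vertices1.
Definition nbrs2 := Eval vm_compute in
  map (kept_nbrs 2 (iota 1 8) (iota 1 9) vertices2) vertices2.

(** The counts of generations 0 to 9 suffice to tell the vertices apart. *)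
Lemma vertices1_check : truncation_check 1 (iota 1 7) (iota 1 8) vertices1 10.
Proof. by vm_compute. Qed.
Lemma vertices2_check : truncation_check 2 (iota 1 8) (iota 1 9) vertices2 10.
Proof. by vm_compute. Qed.

Definition den1m : seq Z := [:: -1;1;0;1;1;0;0;0;-2;-1;-2;0;0;1;0;1]%BZ.
Definition den1p : seq Z := [:: -1;2;-1;1;0;-1;0;0;-1;0;-1;1;-1;1;0;1]%BZ.
Definition den2m : seq Z := [:: 1;-1;-1;0;-1;-1;0;0;1;2;1;1;1;1;-1]%BZ.
Definition den2p : seq Z := [:: 1;-2;0;1;-1;0;1;0;1;0;0;1;0;1;-1]%BZ.

Definition polys1m := Eval vm_compute in transfer_polys 21 den1m nbrs1.
Definition polys1p := Eval vm_compute in transfer_polys 21 den1p (loop_at 20 nbrs1).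
Definition polys2m := Eval vm_compute in transfer_polys 19 den2m nbrs2.
Definition polys2p := Eval vm_compute in transfer_polys 19 den2p (loop_at 21 nbrs2).

Lemma ofZ_small (F : pzRingType) : (ofZ 0 = 0 :> F) * (ofZ 1 = 1 :> F) *
  (ofZ 2 = 2 :> F) * (ofZ (-1) = -1 :> F) * (ofZ (-2) = -2 :> F).
Proof. by []. Qed.

Ltac expand_polyZ :=
  rewrite /= !polyZ_cons polyZ_nil !ofZ_small !polyCN ?(polyC0, polyC1, polyC_natr); ring.

Lemma num1mE : Defs.num F1m = polyZ rat (nth [::] polys1m 0). Proof. by expand_polyZ. Qed.
Lemma den1mE : den F1m = polyZ rat den1m. Proof. by expand_polyZ. Qed.
Lemma num1pE : Defs.num F1p = polyZ rat (nth [::] polys1p 0). Proof. by expand_polyZ. Qed.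
Lemma den1pE : den F1p = polyZ rat den1p. Proof. by expand_polyZ. Qed.
Lemma num2mE : Defs.num F2m = polyZ rat (nth [::] polys2m 0). Proof. by expand_polyZ. Qed.
Lemma den2mE : den F2m = polyZ rat den2m. Proof. by expand_polyZ. Qed.
Lemma num2pE : Defs.num F2p = polyZ rat (nth [::] polys2p 0). Proof. by expand_polyZ. Qed.
Lemma den2pE : den F2p = polyZ rat den2p. Proof. by expand_polyZ. Qed.

(* The digits of r continue with 4975..., so that its bracket must extend over
   nearly half a unit of the last digit. *)
Definition bracket_lo (a : Z) := (1000 * a - 499)%BZ.
Definition bracket_hi (a : Z) := (1000 * a + 499)%BZ.
Definition bracket_den := (10 ^ 23)%BZ.
Definition r20 := 65149869151455837735%BZ.
Definition s20 := 65145978572056851317%BZ.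
Definition t20 := 55979335021175578170%BZ.
Definition u20 := 55977426822528580510%BZ.

(** The factor is 2 - x. Without it dominance fails: at r the moduli of S_1, ..., S_7 for this
    denominator already add up to about 1.2, while |S_0| = 1. The coarse brackets have denominator
    2^14. *)
Lemma analysis1m_check :
  analysis_check 20 nbrs1 den1m polys1m [:: 2; -1]%BZ
    (bracket_lo r20) (bracket_hi r20) bracket_den 10674%BZ 10675%BZ 16384%BZ.
Proof. by vm_compute. Qed.
Lemma analysis1p_check :
  analysis_check 20 (loop_at 20 nbrs1) den1p polys1p [:: 1]%BZ
    (bracket_lo s20) (bracket_hi s20) bracket_den 10673%BZ 10674%BZ 16384%BZ.
Proof. by vm_compute. Qed.
Lemma analysis2m_check :
  analysis_check 21 nbrs2 den2m polys2m [:: 1]%BZ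
    (bracket_lo t20) (bracket_hi t20) bracket_den 9171%BZ 9172%BZ 16384%BZ.
Proof. by vm_compute. Qed.
Lemma analysis2p_check :
  analysis_check 21 (loop_at 21 nbrs2) den2p polys2p [:: 1]%BZ
    (bracket_lo u20) (bracket_hi u20) bracket_den 9171%BZ 9172%BZ 16384%BZ.
Proof. by vm_compute. Qed.

Lemma nbrs1E : map (kept_nbrs 1 (iota 1 7) (iota 1 8) vertices1) vertices1 = nbrs1.
Proof. by vm_compute. Qed.
Lemma nbrs2E : map (kept_nbrs 2 (iota 1 8) (iota 1 9) vertices2) vertices2 = nbrs2.
Proof. by vm_compute. Qed.

Lemma digraph1 : exists (n : nat) (v : 'I_n.+1 -> word),
     [/\ truncation 1 (iota 1 7) (iota 1 8) v,
         walk_gf (adjacency 1 (iota 1 7) (iota 1 8) v) = ratfun_frac F1m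
       & walk_gf (add_loop ord_max (adjacency 1 (iota 1 7) (iota 1 8) v))
           = ratfun_frac F1p].
Proof.
exists 20, (fun i : 'I_21 => nth [::] vertices1 i); split.
- exact: (truncationP vertices1_check).
- rewrite (adjacencyE vertices1_check) // nbrs1E.
  exact: (walk_gf_count_mx analysis1m_check num1mE den1mE).
rewrite (adjacencyE vertices1_check) // nbrs1E add_loop_count_mx //.
exact: (walk_gf_count_mx analysis1p_check num1pE den1pE).
Qed.

Lemma digraph2 : exists (n : nat) (v : 'I_n.+1 -> word),
     [/\ truncation 2 (iota 1 8) (iota 1 9) v,
         walk_gf (adjacency 2 (iota 1 8) (iota 1 9) v) = ratfun_frac F2m
       & walk_gf (add_loop ord_max (adjacency 2 (iota 1 8) (iota 1 9) v))
           = ratfun_frac F2p].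
Proof.
exists 21, (fun i : 'I_22 => nth [::] vertices2 i); split.
- exact: (truncationP vertices2_check).
- rewrite (adjacencyE vertices2_check) // nbrs2E.
  exact: (walk_gf_count_mx analysis2m_check num2mE den2mE).
rewrite (adjacencyE vertices2_check) // nbrs2E add_loop_count_mx //.
exact: (walk_gf_count_mx analysis2p_check num2pE den2pE).
Qed.

Lemma lower1 : \forall n \near \oo, counting_seq F1m n < (num_convex 1 n)%:R.
Proof.
apply: (counting_seq_lt _ (counting_seqE analysis1m_check num1mE den1mE)) => //.
rewrite -nbrs1E.
(* The indices of 123, 1234, ..., 1234567 in [vertices1]. *)
apply: (walks_lt_num_desc vertices1_check (i := 9) (s := [:: 1; 2; 4; 6; 9]%N)) => //.
by move=> m; apply: num_desc_iota_gt0.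
Qed.

Lemma lower2 : \forall n \near \oo, counting_seq F2m n < (num_convex 2 n)%:R.
Proof.
apply: (counting_seq_lt _ (counting_seqE analysis2m_check num2mE den2mE)) => //.
rewrite -nbrs2E.
(* The indices of 123, 1234, ..., 12345678 in [vertices2]. *)
apply: (walks_lt_num_desc vertices2_check (i := 10) (s := [:: 1; 2; 3; 5; 7; 10]%N)) => //.
by move=> m; apply: num_desc_iota_gt0.
Qed.

(** The cut is moved one vertex further, to 12...8 for k = 1 and to 12...9 for k = 2. *)
Definition upper_vertices1 := Eval vm_compute in
  iter 20 (explore 1 (iota 1 8) (iota 1 9)) [:: [:: 1; 2]%N].
Definition upper_vertices2 := Eval vm_compute in
  iter 20 (explore 2 (iota 1 9) (iota 1 10)) [:: [:: 1; 2]%N].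

(* The bounds lie between the growth rates of the looped digraphs, 1.53492... and
   1.78638..., and those of F_+, 1.53501... and 1.78643... *)
Lemma upper_vertices1_check : upper_check 1 8 upper_vertices1 50 1535%BZ 1000%BZ.
Proof. by vm_compute. Qed.
Lemma upper_vertices2_check : upper_check 2 9 upper_vertices2 50 17864%BZ 10000%BZ.
Proof. by vm_compute. Qed.

Lemma one_over_bounds (R : realType) p p' q (r : R) : (0 < p)%BZ -> (0 < q)%BZ ->
  ofZ p / ofZ q <= r <= ofZ p' / ofZ q ->
  ofZ q / ofZ p' <= 1 / r <= ofZ q / ofZ p.
Proof.
move=> p0 q0 rI; have r0 := interval_gt0 p0 q0 rI; case/andP: rI => r1 r2.
have P0 : 0 < ofZ p / ofZ q :> R by rewrite divr_gt0 // -(ofZ0 R) ltr_ofZ; lia.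
rewrite div1r -[ofZ q / ofZ p]invf_div -[ofZ q / ofZ p']invf_div.
by rewrite !lef_pV2 ?posrE // ?r1 ?r2 // (lt_le_trans r0).
Qed.

Lemma root_rounds (R : realType) x ds a' ds' (r : R) :
  ofZ (bracket_lo x) / ofZ bracket_den <= r <= ofZ (bracket_hi x) / ofZ bracket_den ->
  (0 <? bracket_lo x)%BZ && rounds_check (bracket_lo x) (bracket_hi x) bracket_den bracket_den 0 ds ->
  rounds_check bracket_den bracket_den (bracket_hi x) (bracket_lo x) a' ds' ->
  rounds_to r 0 ds /\ rounds_to (1 / r) a' ds'.
Proof.
move=> rI /andP[x0 c1] c2.
have [l0 h0 t0] : [/\ (0 < bracket_lo x)%BZ, (0 < bracket_hi x)%BZ & (0 < bracket_den)%BZ].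
  by move: x0; rewrite /bracket_lo /bracket_hi /bracket_den; clear; split; lia.
have /andP[i1 i2] := one_over_bounds l0 t0 rI; case/andP: rI => r1 r2.
split; [exact: (rounds_checkP t0 t0 r1 r2 c1) | exact: (rounds_checkP h0 l0 i1 i2 c2)].
Qed.

Theorem mainTheorem5 (R : realType) :
  (exists (n : nat) (v : 'I_n.+1 -> word),
     [/\ truncation 1 (iota 1 7) (iota 1 8) v,
         walk_gf (adjacency 1 (iota 1 7) (iota 1 8) v) = ratfun_frac F1m
       & walk_gf (add_loop ord_max (adjacency 1 (iota 1 7) (iota 1 8) v))
           = ratfun_frac F1p]) /\
  (exists (n : nat) (v : 'I_n.+1 -> word),
     [/\ truncation 2 (iota 1 8) (iota 1 9) v,
         walk_gf (adjacency 2 (iota 1 8) (iota 1 9) v) = ratfun_frac F2m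
       & walk_gf (add_loop ord_max (adjacency 2 (iota 1 8) (iota 1 9) v))
           = ratfun_frac F2p]) /\
  exists r s t u : R,
    [/\ unique_minimal_root (den F1m) r,
        unique_minimal_root (den F1p) s,
        unique_minimal_root (den F2m) t
      & unique_minimal_root (den F2p) u] /\
    [/\ rounds_to r 0 [:: 6;5;1;4;9;8;6;9;1;5;1;4;5;5;8;3;7;7;3;5]%N,
        rounds_to s 0 [:: 6;5;1;4;5;9;7;8;5;7;2;0;5;6;8;5;1;3;1;7]%N,
        rounds_to t 0 [:: 5;5;9;7;9;3;3;5;0;2;1;1;7;5;5;7;8;1;7;0]%N
      & rounds_to u 0 [:: 5;5;9;7;7;4;2;6;8;2;2;5;2;8;5;8;0;5;1;0]%N] /\
    [/\ rounds_to (1 / r) 1 [:: 5;3;4;9;2;2;4;9;9;5]%N,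
        rounds_to (1 / s) 1 [:: 5;3;5;0;1;4;1;6;7]%N,
        rounds_to (1 / t) 1 [:: 7;8;6;3;7;3;4;8;9]%N
      & rounds_to (1 / u) 1 [:: 7;8;6;4;3;4;3;8;4]%N] /\
    ((\forall n \near \oo, counting_seq F1m n < (num_convex 1 n)%:R) /\
     exp_growth F1m (1 / r)) /\
    ((\forall n \near \oo, counting_seq F2m n < (num_convex 2 n)%:R) /\
     exp_growth F2m (1 / t)) /\
    ((\forall n \near \oo, (num_convex 1 n)%:R < counting_seq F1p n) /\
     exp_growth F1p (1 / s)) /\
    ((\forall n \near \oo, (num_convex 2 n)%:R < counting_seq F2p n) /\
     exp_growth F2p (1 / u)).
Proof.
have [r [rI rmin rgrow _]] := analysis analysis1m_check num1mE den1mE R.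
have [s sF] := analysis analysis1p_check num1pE den1pE R.
have [t [tI tmin tgrow _]] := analysis analysis2m_check num2mE den2mE R.
have [u uF] := analysis analysis2p_check num2pE den2pE R.
have [sI smin sgrow _] := sF; have [uI umin ugrow _] := uF.
have [r1 r2] := root_rounds
  (ds := [:: 6;5;1;4;9;8;6;9;1;5;1;4;5;5;8;3;7;7;3;5]%N)
  (a' := 1) (ds' := [:: 5;3;4;9;2;2;4;9;9;5]%N) rI
  ltac:(by vm_compute) ltac:(by vm_compute).
have [s1 s2] := root_rounds
  (ds := [:: 6;5;1;4;5;9;7;8;5;7;2;0;5;6;8;5;1;3;1;7]%N)
  (a' := 1) (ds' := [:: 5;3;5;0;1;4;1;6;7]%N) sI
  ltac:(by vm_compute) ltac:(by vm_compute).
have [t1 t2] := root_rounds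
  (ds := [:: 5;5;9;7;9;3;3;5;0;2;1;1;7;5;5;7;8;1;7;0]%N)
  (a' := 1) (ds' := [:: 7;8;6;3;7;3;4;8;9]%N) tI
  ltac:(by vm_compute) ltac:(by vm_compute).
have [u1 u2] := root_rounds
  (ds := [:: 5;5;9;7;7;4;2;6;8;2;2;5;2;8;5;8;0;5;1;0]%N)
  (a' := 1) (ds' := [:: 7;8;6;4;3;4;3;8;4]%N) uI
  ltac:(by vm_compute) ltac:(by vm_compute).
have upper1 : \forall n \near \oo, (num_convex 1 n)%:R < counting_seq F1p n.
  apply: (counting_seq_gt _ (counting_seqE analysis1p_check num1pE den1pE)) => //.
  (* The computation verifies 1.535 s < 1 at the upper end of the bracket of s; for k = 2 it is
     1.7864 u < 1. *)
  by apply: (num_desc_lt_walks upper_vertices1_check _ _ sF); vm_compute.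
have upper2 : \forall n \near \oo, (num_convex 2 n)%:R < counting_seq F2p n.
  apply: (counting_seq_gt _ (counting_seqE analysis2p_check num2pE den2pE)) => //.
  by apply: (num_desc_lt_walks upper_vertices2_check _ _ uF); vm_compute.
split; first exact: digraph1.
split; first exact: digraph2.
exists r, s, t, u.
split; first by split.
split; first by split.
split; first by split.
split; first by split; [exact: lower1|].
split; first by split; [exact: lower2|].
by split; split.
Qed.
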